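(* Let $\pi:E\to M$ be a fiber bundle over an orientable $m$-dimensional manifold $M$ with volume form $\eta$ and $n$-dimensional fibers, let $k\ge 1$, and let $L:J^k\pi\to\mathbb{R}$ be a smooth Lagrangian. Let $W_0=J^k\pi\times_{J^{k-1}\pi}\Lambda^m_2(J^{k-1}\pi)$, with its form $\Omega_{H_0}$, and let $W_f\subset W_0$ be the final constraint submanifold (all defined in the context), with canonical inclusion $i:W_f\hookrightarrow W_0$. Let $\mathbf{h}$ be the horizontal projector of a connection in $\pi_{W_0,M}:W_0\to M$ along $W_f$ which is a solution of the dynamical equation $i_{\mathbf h}\Omega_{H_0}=(m-1)\Omega_{H_0}$ at the points of $W_f$. Let $\bar\sigma$ be a section of $\pi_{W_f,M}:W_f\to M$ and put $\sigma=i\circ\bar\sigma$. If $\bar\sigma$ is an integral section of $\mathbf h$, then $\bar\sigma$ is holonomic, in the sense that $$\mathit{pr}_1\circ\sigma=j^k(\pi_{W_f,E}\circ\bar\sigma),$$ and it satisfies the higher-order Euler-Lagrange equations: in adapted coordinates, for every $\alpha=1,\dots,n$, $$j^{2k}(\pi_{W_f,E}\circ\bar\sigma)^*\left(\sum_{|J|=0}^{k}(-1)^{|J|}\frac{d^{|J|}}{dx^J}\frac{\partial L}{\partial u^\alpha_J}\right)=0 .$$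
   Context: **Multi-indices.** A multi-index $I$ is an $m$-tuple of non-negative integers with components $I(i)$; $|I|=\sum_i I(i)$; $1_i$ is the multi-index with $1$ in position $i$ and $0$ elsewhere; addition is componentwise. Repeated indices and multi-indices are summed. **Jets.** $J^k\pi$ is the $k$-th jet manifold of $\pi$, with $J^0\pi=E$, and projections $\pi_k:J^k\pi\to M$, $\pi_{k,l}:J^k\pi\to J^l\pi$. $j^k\phi$ is the $k$-jet prolongation of a (local) section $\phi$ of $\pi$. Adapted coordinates $(x^i,u^\alpha)$ on $E$, chosen so that $\eta=d^mx:=dx^1\wedge\dots\wedge dx^m$, induce coordinates $(x^i,u^\alpha_J)$, $0\le|J|\le k$, on $J^k\pi$, with $u^\alpha_J(j^k_p\phi)=\partial^{|J|}\phi^\alpha/\partial x^J|_p$. Write $d^{m-1}x_i=i_{\partial/\partial x^i}d^mx$. $\frac{d}{dx^i}$ denotes the total derivative, $\frac{d f}{dx^i}=\frac{\partial f}{\partial x^i}+\sum_J u^\alpha_{J+1_i}\frac{\partial f}{\partial u^\alpha_J}$, and $\frac{d^{|J|}}{dx^J}$ is the corresponding iterated total derivative. **The space $W_0$.** $\Lambda^m_2(J^{k-1}\pi)$ is the bundle of $m$-forms on $J^{k-1}\pi$ that vanish when two of their arguments are $\pi_{k-1}$-vertical. Its elements are locally $p\,d^mx+p^{I,i}_\alpha\,du^\alpha_I\wedge d^{m-1}x_i$ with $0\le|I|\le k-1$, which gives coordinates $(x^i,u^\alpha_I,p,p^{I,i}_\alpha)$. Its canonical multisymplectic $(m+1)$-form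 is $\Omega=-dp\wedge d^mx-dp^{I,i}_\alpha\wedge du^\alpha_I\wedge d^{m-1}x_i$. The manifold $W_0=J^k\pi\times_{J^{k-1}\pi}\Lambda^m_2(J^{k-1}\pi)$ has projections $\mathit{pr}_1:W_0\to J^k\pi$, $\mathit{pr}_2:W_0\to\Lambda^m_2(J^{k-1}\pi)$, $\pi_{W_0,M}:W_0\to M$, and coordinates $(x^i,u^\alpha_J,p^{I,i}_\alpha,p)$ with $0\le|J|\le k$, $0\le|I|\le k-1$. The pullback of $\Omega$ to $W_0$ is again denoted $\Omega$. The pairing $\Phi:W_0\to\mathbb{R}$ is defined by $\Phi(j^k_x\phi,\omega)\,\eta(x)=(j^{k-1}\phi)^*\omega$ for $\omega\in\Lambda^m_2(J^{k-1}\pi)$ over $j^{k-1}_x\phi$; in coordinates $\Phi=p^{I,i}_\alpha u^\alpha_{I+1_i}+p$. Set $H_0=\Phi-L\circ\mathit{pr}_1$ and $\Omega_{H_0}=\Omega+dH_0\wedge\eta$ (with $\eta$ pulled back to $W_0$). **Dynamical equation.** For a linear map $\mathbf h_w:T_wW_0\to T_wW_0$, $(i_{\mathbf h_w}\Omega_{H_0})(v_1,\dots,v_{m+1})=\sum_{a}\Omega_{H_0}(v_1,\dots,\mathbf h_w v_a,\dots,v_{m+1})$. Say that $\mathbf h_w$ is admissible at $w$ if $\mathbf h_w^2=\mathbf h_w$, $\ker\mathbf h_w=(V\pi_{W_0,M})_w$ (the vertical space), and $i_{\mathbf h_w}\Omega_{H_0}(w)=(m-1)\Omega_{H_0}(w)$.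 **Constraint algorithm.** $W_1=\{w\in W_0:\text{ there is an admissible }\mathbf h_w:T_wW_0\to T_wW_0\}$; $W_2=\{w\in W_1: H_0(w)=0\}$; and for $r\ge2$, $W_{r+1}=\{w\in W_r:\text{ there is an admissible }\mathbf h_w\text{ with }\mathbf h_w(T_wW_0)\subset T_wW_r\}$. All $W_r$ are assumed to be submanifolds. The final constraint submanifold $W_f$ is the one at which this sequence stabilizes (assumed to exist and to be fibered over $M$, or over an open subset of $M$); when $k,m>1$ it is $W_f=W_2$. $\pi_{W_f,M}:W_f\to M$ and $\pi_{W_f,E}:W_f\to E$ are the restrictions to $W_f$ of the natural projections of $W_0$ onto $M$ and $E$. **Connection along $W_f$.** A connection in $\pi_{W_0,M}:W_0\to M$ along $W_f$ is a family of linear maps $\mathbf h_w:T_wW_0\to T_wW_f$, $w\in W_f$, with $\mathbf h_w^2=\mathbf h_w$ and $\ker\mathbf h_w=(V\pi_{W_0,M})_w$. A section $\bar\sigma$ is an integral section of $\mathbf h$ if the image of $T_x\sigma$ equals $\mathbf h_{\sigma(x)}(T_{\sigma(x)}W_0)$ for every $x$ in its domain. *)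

(* Defs.v *)
From HB Require Import structures.
From mathcomp Require Import all_boot all_order all_algebra.
From mathcomp Require Import all_classical all_reals all_analysis.
Set Implicit Arguments.
Unset Strict Implicit.
Unset Printing Implicit Defensive.
Import Order.TTheory GRing.Theory Num.Theory.
Import numFieldNormedType.Exports.
Local Open Scope classical_set_scope.
Local Open Scope ring_scope.

(* C^r on an open set U of a finite-dimensional space; U is always open in the
   uses below. *)
Fixpoint Cr_on (R : realType) (V W : normedModType R) (r : nat) (U : set V)
    (f : V -> W) : Prop :=
  match r with
  | 0 => forall x, U x -> {for x, continuous f}
  | r'.+1 => (forall x, U x -> differentiable f x) /\
             forall v : V, Cr_on r' U (fun x => 'D_v f x)
  end.

Definition smooth_on (R : realType) (V W : normedModType R) (U : set V)
    (f : V -> W) : Prop := forall r, Cr_on r U f.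

Record chart (R : realType) (T : topologicalType) (n : nat) := Chart {
  cdom : set T;
  cfun : T -> 'rV[R]_n;
  cinv : 'rV[R]_n -> T;
  cdom_open : open cdom;
  crange_open : open (cfun @` cdom);
  cfunK : forall x, cdom x -> cinv (cfun x) = x;
  cfun_cont : forall x, cdom x -> {for x, continuous cfun};
  cinv_cont : forall y, (cfun @` cdom) y -> {for y, continuous cinv}
}.

Definition chart_compat (R : realType) (T : topologicalType) (n : nat)
    (c d : chart R T n) : Prop :=
  smooth_on (cfun c @` (cdom c `&` cdom d)) (cfun d \o cinv c) /\
  smooth_on (cfun d @` (cdom c `&` cdom d)) (cfun c \o cinv d).

Record manifold (R : realType) (n : nat) := Manifold {
  mcar :> topologicalType;
  atlas : set (chart R mcar n);
  man_hausdorff : hausdorff_space mcar;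
  man_countable : @second_countable mcar;
  atlas_cover : forall x, exists2 c, atlas c & cdom c x;
  atlas_compat : forall c d, atlas c -> atlas d -> chart_compat c d;
  atlas_max : forall c, (forall d, atlas d -> chart_compat c d) -> atlas c
}.

(* A nowhere vanishing smooth m-form on an m-manifold, given by its component
   eta_c in every chart c: eta = eta_c dx^1 /\ ... /\ dx^m. *)
Record volume_form (R : realType) (m : nat) (M : manifold R m) := VolumeForm {
  vol : chart R M m -> M -> R;
  vol_smooth : forall c, atlas c ->
    smooth_on (cfun c @` cdom c) (fun y => (vol c (cinv c y) : R^o));
  vol_neq0 : forall c x, atlas c -> cdom c x -> vol c x != 0;
  vol_change : forall c d x, atlas c -> atlas d -> cdom c x -> cdom d x ->
    vol c x = \det (jacobian (cfun d \o cinv c) (cfun c x)) * vol d x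
}.

(* [fb_trivial]: over U the map e |-> (proj e, psi e) is a bijection onto
   U * fib which pulls the product charts back to charts of the total space,
   i.e. it is a diffeomorphism. *)
Record fbundle (R : realType) (m n : nat) := FBundle {
  base : manifold R m;
  total : manifold R (m + n);
  fib : manifold R n;
  proj : total -> base;
  fb_surj : forall x, exists e, proj e = x;
  fb_trivial : forall x0 : base, exists (U : set base) (psi : total -> fib),
    [/\ open U, U x0,
        (forall x y, U x -> exists! e, proj e = x /\ psi e = y) &
        forall (b : chart R base m) (f : chart R fib n),
          atlas b -> atlas f -> cdom b `<=` U ->
          exists c : chart R total (m + n), [/\ atlas c,
            cdom c = [set e | cdom b (proj e) /\ cdom f (psi e)] &
            forall e, cdom c e ->
              cfun c e = row_mx (cfun b (proj e)) (cfun f (psi e))]]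
}.

(* Fibred coordinates (x^i, u^alpha) on the total space: the first m components
   of fct are the x^i, the last n are the u^alpha. No relation with eta is
   required here, see [adapted]. *)
Record fchart (R : realType) (m n : nat) (B : fbundle R m n) := FChart {
  fcb : chart R (base B) m;
  fct : chart R (total B) (m + n);
  fcb_atlas : atlas fcb;
  fct_atlas : atlas fct;
  fc_fibred : forall e, cdom fct e ->
    cdom fcb (proj e) /\ lsubmx (cfun fct e) = cfun fcb (proj e)
}.

Definition adapted (R : realType) (m n : nat) (B : fbundle R m n)
    (eta : volume_form (base B)) (c : fchart B) : Prop :=
  forall x, cdom (fcb c) x -> vol eta (fcb c) x = 1.

Section Coordinates.
Context {R : realType} {T : finType}.

Definition tcrd (y : 'rV[R]_#|T|) (t : T) : R := y 0 (enum_rank t).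
Definition tvec (F : T -> R) : 'rV[R]_#|T| := \row_j F (enum_val j).
Definition tbasis (t : T) : 'rV[R]_#|T| := delta_mx 0 (enum_rank t).
Definition pd (t : T) (f : 'rV[R]_#|T| -> R) (y : 'rV[R]_#|T|) : R :=
  'D_(tbasis t) (f : _ -> R^o) y.

End Coordinates.

Section MultiIndex.
Context {m : nat}.

Definition mi (r : nat) : finType :=
  {J : {ffun 'I_m -> 'I_r.+1} | (\sum_(i < m) (J i : nat) <= r)%N}.

Definition mi_fun r (J : mi r) : 'I_m -> nat := fun i => val J i.

Definition mi_norm r (J : mi r) : nat := (\sum_(i < m) mi_fun J i)%N.

Lemma mi0_subproof r :
  (\sum_(i < m) ([ffun=> ord0] : {ffun 'I_m -> 'I_r.+1}) i <= r)%N.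
Proof. by rewrite big1 // => i _; rewrite ffunE. Qed.

Definition mi0 r : mi r := exist _ [ffun=> ord0] (mi0_subproof r).

(* J as a multi-index of length at most r; only used when |J| <= r. *)
Definition mi_in r (J : 'I_m -> nat) : mi r :=
  insubd (mi0 r) [ffun i => inord (J i)].

Definition mi_succ r (J : mi r) (i : 'I_m) : mi r.+1 :=
  mi_in r.+1 (fun j => mi_fun J j + (j == i))%N.

Definition mi_seq r (J : mi r) : seq 'I_m :=
  flatten [seq nseq (mi_fun J i) i | i <- enum 'I_m].

End MultiIndex.
Arguments mi : clear implicits.

(* Indices of the coordinates (x^i, u^alpha_J), |J| <= r, of the r-jets. *)
Definition jidx (m n r : nat) : finType := ('I_m + 'I_n * mi m r)%type.

(* Indices of the coordinates (x^i, u^alpha_J, p^{I,i}_alpha, p) of W_0, with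
   |J| <= k and |I| <= k - 1. *)
Definition widx (m n k : nat) : finType :=
  (jidx m n k + ('I_n * mi m k.-1 * 'I_m) + unit)%type.

Section IndexNames.
Context {m n k : nat}.
Definition wx (i : 'I_m) : widx m n k := inl (inl (inl i)).
Definition wu (al : 'I_n) (J : mi m k) : widx m n k := inl (inl (inr (al, J))).
Definition wpI (al : 'I_n) (I : mi m k.-1) (i : 'I_m) : widx m n k :=
  inl (inr (al, I, i)).
Definition wp : widx m n k := inr tt.
End IndexNames.

Section TotalDerivative.
Context {R : realType} {m n : nat}.

Definition jtrunc r l (y : 'rV[R]_#|jidx m n r|) : 'rV[R]_#|jidx m n l| :=
  tvec (fun t : jidx m n l => match t with
    | inl i => tcrd y (inl i : jidx m n r)
    | inr (al, J) => tcrd y (inr (al, mi_in r (mi_fun J)) : jidx m n r)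
    end).

(* d/dx^i; the total derivative of a function on r-jets lives on (r+1)-jets. *)
Definition dtot r (i : 'I_m) (f : 'rV[R]_#|jidx m n r| -> R)
    (y : 'rV[R]_#|jidx m n r.+1|) : R :=
  pd (inl i : jidx m n r) f (jtrunc r y) +
  \sum_(al < n) \sum_(J : mi m r)
     tcrd y (inr (al, mi_succ J i) : jidx m n r.+1) *
     pd (inr (al, J) : jidx m n r) f (jtrunc r y).

Fixpoint dtots r (s : seq 'I_m) (f : 'rV[R]_#|jidx m n r| -> R) :
    'rV[R]_#|jidx m n (size s + r)| -> R :=
  match s return 'rV[R]_#|jidx m n (size s + r)| -> R with
  | [::] => f
  | i :: s' => dtot i (@dtots r s' f)
  end.

(* The J-th summand lives on (k+|J|)-jets; [jtrunc] pulls it back to 2k-jets. *)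
Definition euler_lagrange k (L : 'rV[R]_#|jidx m n k| -> R) (al : 'I_n)
    (y : 'rV[R]_#|jidx m n (2 * k)%N|) : R :=
  \sum_(J : mi m k) (-1) ^+ mi_norm J *
    @dtots k (mi_seq J) (pd (inr (al, J) : jidx m n k) L) (jtrunc _ y).

End TotalDerivative.

Section Charted.
Context {R : realType} {m n : nat} {B : fbundle R m n}.

(* E, J^r pi and W_0 all carry one induced chart for each fibred chart of E. *)
Record cspace := CSpace {
  cs_dim : nat;
  cs_pt :> Type;
  cs_dom : fchart B -> set cs_pt;
  cs_crd : fchart B -> cs_pt -> 'rV[R]_cs_dim
}.

(* The local representative of f in the chart c, extended by 0 outside the
   image of the chart; that image is open, so derivatives taken at points of it
   do not see the extension. *)
Definition rep (X : cspace) (V : nmodType) (c : fchart B) (f : X -> V)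
    (y : 'rV[R]_(cs_dim X)) : V :=
  if pselect (exists p : X, cs_dom c p /\ cs_crd c p = y) is left h
  then f (sval (cid h)) else 0.

(* Tensors at a point p are handled through their components in the charts
   around p, related by the usual transformation rule. The components of a
   tangent vector form a row vector: v in the chart c becomes v *m jac c d p in
   the chart d. *)
Definition jac (X : cspace) (c d : fchart B) (p : X) : 'M[R]_(cs_dim X) :=
  jacobian (rep c (@cs_crd X d)) (cs_crd c p).

Definition smooth_fun (X : cspace) (f : X -> R) : Prop :=
  forall c, exists2 g : 'rV[R]_(cs_dim X) -> R^o,
    smooth_on (@cs_crd X c @` cs_dom c) g &
    forall p : X, cs_dom c p -> f p = g (cs_crd c p).

Definition smooth_at (X : cspace) (f : base B -> X) (x : base B) : Prop :=
  forall c, cs_dom c (f x) -> exists V : set (base B),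
    [/\ open V, V x, V `<=` cdom (fcb c), (forall y, V y -> cs_dom c (f y)) &
        smooth_on (cfun (fcb c) @` V) (@cs_crd X c \o f \o cinv (fcb c))].

(* A linear endomorphism of T_p X, given by its matrix in every chart around
   p (acting on the right on row vectors). *)
Definition tangent_endo (X : cspace) (p : X)
    (H : fchart B -> 'M[R]_(cs_dim X)) : Prop :=
  forall c d, cs_dom c p -> cs_dom d p ->
    H c *m jac c d p = jac c d p *m H d.

(* The components in the chart c of the vectors tangent at p to the subset S:
   velocities of smooth curves of X contained in S. *)
Definition tangent_sub (X : cspace) (S : set X) (p : X) (c : fchart B) :
    set 'rV[R]_(cs_dim X) :=
  [set v | exists (gam : R -> X) (e : R), [/\ 0 < e, gam 0 = p,
     (forall t, `|t| < e -> S (gam t) /\ cs_dom c (gam t)),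
     smooth_on [set t : R^o | `|t| < e] (fun t : R^o => cs_crd c (gam t)) &
     'D_(1 : R^o) (fun t : R^o => cs_crd c (gam t)) 0 = v]].

(* Embedded submanifolds of dimension q: near each of its points S is
   straightened by a local diffeomorphism G of the coordinate space. *)
Definition submanifold (X : cspace) (S : set X) : Prop :=
  exists q : nat, forall p, S p -> forall c, cs_dom c p ->
  exists (O : set 'rV[R]_(cs_dim X))
         (G G' : 'rV[R]_(cs_dim X) -> 'rV[R]_(cs_dim X)),
    [/\ (open O /\ O (cs_crd c p)), (open (G @` O) /\ (q <= cs_dim X)%N),
        (smooth_on O G /\ smooth_on (G @` O) G'),
        (forall y, O y -> G' (G y) = y) &
        forall p' : X, cs_dom c p' -> O (cs_crd c p') ->
          (S p' <-> forall j : 'I_(cs_dim X), (q <= j)%N ->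
                      G (cs_crd c p') 0 j = 0)].

Definition Espace : cspace :=
  @CSpace (m + n) (total B) (fun c => cdom (fct c)) (fun c => cfun (fct c)).

Definition lsec (x : base B) (phi : base B -> total B) : Prop :=
  (\forall y \near x, proj (phi y) = y) /\ smooth_at (phi : _ -> Espace) x.

(* The coordinates (x^i, d^|J| phi^alpha / dx^J) of the r-jet of phi at x. *)
Definition jcrd r (c : fchart B) (phi : base B -> total B) (x : base B) :
    'rV[R]_#|jidx m n r| :=
  tvec (fun t : jidx m n r => match t with
    | inl i => cfun (fcb c) x 0 i
    | inr (al, J) =>
        foldr (fun i (g : 'rV[R]_m -> R^o) => 'D_(delta_mx 0 i) g)
          (fun y => rsubmx (cfun (fct c) (phi (cinv (fcb c) y))) 0 al)
          (mi_seq J) (cfun (fcb c) x)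
    end).

Definition contact r (x : base B) (phi psi : base B -> total B) : Prop :=
  phi x = psi x /\
  forall c, cdom (fct c) (phi x) -> jcrd r c phi x = jcrd r c psi x.

Record jet r := Jet {
  jbase : base B;
  jclass : set (base B -> total B);
  jclass_ex : exists2 phi, lsec jbase phi &
    jclass = [set psi | lsec jbase psi /\ contact r jbase phi psi]
}.

Definition jet_at r (x : base B) (phi : base B -> total B)
    (h : lsec x phi) : jet r :=
  @Jet r x [set psi | lsec x psi /\ contact r x phi psi]
    (ex_intro2 _ _ phi h erefl).

Definition jrep r (z : jet r) : base B -> total B := s2val (cid2 (jclass_ex z)).
Definition jrep_lsec r (z : jet r) : lsec (jbase z) (jrep z) :=
  s2valP (cid2 (jclass_ex z)).

(* pi_{r,l}, for l <= r *)
Definition jproj r l (z : jet r) : jet l := jet_at l (jrep_lsec z).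

Definition jtotal r (z : jet r) : total B := jrep z (jbase z).

Definition Jspace r : cspace :=
  @CSpace #|jidx m n r| (jet r) (fun c z => cdom (fct c) (jtotal z))
    (fun c z => jcrd r c (jrep z) (jbase z)).

Definition jvertical r (v : 'rV[R]_#|jidx m n r|) : Prop :=
  forall i, tcrd v (inl i : jidx m n r) = 0.

Definition form2 r (om : ('I_m -> 'rV[R]_#|jidx m n r|) -> R) : Prop :=
  [/\ (forall v a (s : R) y,
         om (fun b => if b == a then s *: y + v a else v b) =
         s * om (fun b => if b == a then y else v b) + om v),
      (forall v a b, a != b -> v a = v b -> om v = 0) &
      (forall v a b, a != b -> jvertical (v a) -> jvertical (v b) ->
         om v = 0)].

(* The fibre of Lambda^m_2(J^r pi) over z: the components of the form in one
   chart c0 around z determine those in the other charts around z; charts not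
   around z get the value 0. *)
Definition Lambda2 r (z : jet r) : Type :=
  {om : fchart B -> ('I_m -> 'rV[R]_#|jidx m n r|) -> R |
    (exists c0, [/\ cs_dom c0 (z : Jspace r), form2 (om c0) &
       forall c, cs_dom c (z : Jspace r) -> forall v,
         om c v = om c0 (fun a => v a *m jac c c0 (z : Jspace r))]) /\
    (forall c, ~ cs_dom c (z : Jspace r) -> forall v, om c v = 0)}.

Record W0 k := MkW0 {
  wjet : jet k;
  wform : Lambda2 (jproj k.-1 wjet)
}.

Definition wbase k (w : W0 k) : base B := jbase (wjet w).
Definition wtotal k (w : W0 k) : total B := jtotal (wjet w).

(* p and p^{I,i}_alpha are the components of
   p d^m x + p^{I,i}_alpha du^alpha_I /\ d^{m-1}x_i, where
   du /\ d^{m-1}x_i = dx^1 /\ ... /\ du /\ ... /\ dx^m with du replacing dx^i. *)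
Definition wcrd k (c : fchart B) (w : W0 k) : 'rV[R]_#|widx m n k| :=
  let om := sval (wform w) c in
  let ex (a : 'I_m) := tbasis (inl a : jidx m n k.-1) in
  tvec (fun t : widx m n k => match t with
    | inl (inl t') => tcrd (jcrd k c (jrep (wjet w)) (wbase w)) t'
    | inl (inr (al, J, i)) =>
        om (fun a => if a == i then tbasis (inr (al, J) : jidx m n k.-1)
                     else ex a)
    | inr tt => om ex
    end).

Definition Wspace k : cspace :=
  @CSpace #|widx m n k| (W0 k) (fun c w => cdom (fct c) (wtotal w))
    (@wcrd k).

Definition wvertical k (v : 'rV[R]_#|widx m n k|) : Prop :=
  forall i, tcrd v (wx i) = 0.

(* theta_1 /\ ... /\ theta_s, evaluated as det (theta_a (v_b)). *)
Definition wedge (N s : nat) (th : 'I_s -> 'rV[R]_N -> R)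
    (v : 'I_s -> 'rV[R]_N) : R :=
  \det (\matrix_(a, b) th a (v b)).

Definition fcons (T : Type) s (t0 : T) (t : 'I_s -> T) (a : 'I_s.+1) : T :=
  if unlift ord0 a is Some b then t b else t0.

Section Dynamics.
Context {k : nat} (eta : volume_form (base B)).

Definition dcrd (t : widx m n k) (v : 'rV[R]_#|widx m n k|) : R := tcrd v t.
Definition dx (a : 'I_m) := dcrd (wx a).

(* The coordinate formula of Omega is the same in all fibred charts, whether or
   not eta = d^m x there. *)
Definition Omega (v : 'I_m.+1 -> 'rV[R]_#|widx m n k|) : R :=
  - wedge (fcons (dcrd wp) dx) v
  - \sum_(al < n) \sum_(I : mi m k.-1) \sum_(i < m)
      wedge (fcons (dcrd (wpI al I i))
               (fun a => if a == i
                         then dcrd (wu al (mi_in k (mi_fun I)))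
                         else dx a)) v.

(* Phi(j^k_x phi, om) eta(x) = (j^{k-1} phi)^* om, as an equation between the
   coefficients of d^m x; it determines Phi. *)
Definition is_pairing (Phi : W0 k -> R) : Prop :=
  forall w phi c, jclass (wjet w) phi -> cdom (fct c) (phi (wbase w)) ->
    Phi w * vol eta (fcb c) (wbase w) =
    sval (wform w) c (fun i =>
      'D_(delta_mx 0 i) (fun y => jcrd k.-1 c phi (cinv (fcb c) y))
        (cfun (fcb c) (wbase w))).

Definition H0 (Phi : W0 k -> R) (L : jet k -> R) (w : W0 k) : R :=
  Phi w - L (wjet w).

Context (Phi : W0 k -> R) (L : jet k -> R).

Definition OmegaH (w : W0 k) (c : fchart B)
    (v : 'I_m.+1 -> 'rV[R]_#|widx m n k|) : R :=
  let dH u := 'D_u (rep (X := Wspace k) c (H0 Phi L : _ -> R^o))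
                (wcrd c w) in
  Omega v + vol eta (fcb c) (wbase w) * wedge (fcons dH dx) v.

Definition horizontal_projector (w : W0 k)
    (H : fchart B -> 'M[R]_#|widx m n k|) : Prop :=
  tangent_endo (w : Wspace k) H /\
  forall c, cs_dom c (w : Wspace k) ->
    H c *m H c = H c /\ forall v, v *m H c = 0 <-> wvertical v.

Definition dynamical_eq (w : W0 k)
    (H : fchart B -> 'M[R]_#|widx m n k|) : Prop :=
  forall c, cs_dom c (w : Wspace k) -> forall v,
    \sum_(a < m.+1) OmegaH w c (fun b => if b == a then v b *m H c else v b) =
    (m%:R - 1) * OmegaH w c v.

Definition admissible (w : W0 k)
    (H : fchart B -> 'M[R]_#|widx m n k|) : Prop :=
  horizontal_projector w H /\ dynamical_eq w H.

Definition takes_values_in (S : set (W0 k)) (w : W0 k)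
    (H : fchart B -> 'M[R]_#|widx m n k|) : Prop :=
  forall c, cs_dom c (w : Wspace k) -> forall v,
    tangent_sub (X := Wspace k) S w c (v *m H c).

Fixpoint Wr (r : nat) : set (W0 k) :=
  match r with
  | 0 => setT
  | r1.+1 => match r1 with
    | 0 => [set w | exists H, admissible w H]
    | r2.+1 => match r2 with
      | 0 => Wr r1 `&` [set w | H0 Phi L w = 0]
      | _.+1 => Wr r1 `&` [set w | exists H,
                  admissible w H /\ takes_values_in (Wr r1) w H]
      end
    end
  end.

End Dynamics.

Definition fibred_over_open k (S : set (W0 k)) : Prop :=
  open (@wbase k @` S) /\
  forall w c, S w -> cs_dom c (w : Wspace k) -> forall xi : 'rV[R]_m,
    exists2 v, tangent_sub (X := Wspace k) S w c v &
               forall i, tcrd v (wx i) = xi 0 i.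

Definition connection_along k (S : set (W0 k))
    (h : W0 k -> fchart B -> 'M[R]_#|widx m n k|) : Prop :=
  forall w, S w -> horizontal_projector w (h w) /\ takes_values_in S w (h w).

Definition section_on k (S : set (W0 k)) (U : set (base B))
    (sig : base B -> W0 k) : Prop :=
  open U /\ forall x, U x ->
    [/\ S (sig x), wbase (sig x) = x & smooth_at (sig : _ -> Wspace k) x].

Definition integral_section k (h : W0 k -> fchart B -> 'M[R]_#|widx m n k|)
    (U : set (base B)) (sig : base B -> W0 k) : Prop :=
  forall x, U x -> forall c, cs_dom c (sig x : Wspace k) ->
    range (fun xi : 'rV[R]_m =>
             'D_xi (fun y => wcrd c (sig (cinv (fcb c) y))) (cfun (fcb c) x)) =
    range (fun v : 'rV[R]_#|widx m n k| => v *m h (sig x) c).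

End Charted.
Arguments cspace {R m n} B.
Arguments jet {R m n} B r.
Arguments W0 {R m n} B k.
Arguments Jspace {R m n} B r.

(* Main.v *)
From HB Require Import structures.
From mathcomp Require Import all_boot all_order all_algebra.
From mathcomp Require Import all_classical all_reals all_analysis.
From mathcomp Require Import perm ring.
Require Import Defs.
Set Implicit Arguments.
Unset Strict Implicit.
Unset Printing Implicit Defensive.
Import Order.TTheory GRing.Theory Num.Theory.
Import numFieldNormedType.Exports.
Local Open Scope classical_set_scope.
Local Open Scope ring_scope.

(* Let e_i be the velocities of sigma: h fixes them, and h kills every vertical
   vector xi. Evaluated on (xi, e_1, ..., e_m), the dynamical equation reads
   m Omega_H = (m - 1) Omega_H, so Omega_H (xi, e_1, ..., e_m) = 0. In any fibred
   chart xi = d/dp^{I,i} gives D_i u_I = u_{I+1_i}, whence sigma is holonomic by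
   induction on |I|, and xi = d/du_J gives
     sum_i D_i p^{J,i} + sum_(I+1_i=J) p^{I,i} = vol dL/du_J
   (no first sum when |J| = k). In an adapted chart vol = 1, and the alternating
   sum of the D_J of these equations cancels term by term.

   The derivatives of H_0 and L are those of their local representatives, which
   are extended by 0; they are meaningful because the charts of J^k pi and of W_0
   have open images, every coordinate vector over a chart of E being realized by
   a Taylor polynomial and by a form with prescribed components. *)

(** The first argument is vertical so that every wedge collapses: dx^a vanishes on xi and is dual to
    the velocities, which leaves at most two products of each determinant. Only vertical derivatives
    of H_0 then occur. Vertical lines fix the base point, so vol is constant along them, and vol H_0
    is differentiated as the explicit p + p^{I,i} u_{I+1_i} - vol L. Contact of local sections tests
    the derivatives in every fibred chart, adapted or not. Holonomy is therefore derived separately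
    in each chart, and the factor vol stays until the Euler-Lagrange equations. A local
    representative is evaluated at some chosen point with the given coordinates, and the charts of
    the jets and of W_0 are never shown injective; each use has to check that the choice does not
    affect the value. Distinct pairs (I, i) may share the same I + 1_i, so the equations constrain
    only sums of momenta. The final cancellation nevertheless takes place for each pair (I, i)
    separately. *)

(** * Smooth maps *)

Section Smoothness.
Context {R : realType}.
Implicit Types V W : normedModType R.

(** The differential of f satisfies the first-order expansion of g at x, and such an expansion
    determines the differential. *)
Lemma near_eq_differentiable V W (f g : V -> W) (x : V) :
  (\near x, f x = g x) -> differentiable f x -> differentiable g x.
Proof.
move=> fg df.
suff E : g \o shift x = cst (g x) + 'd f x +o_ (0 : V) id.
  have dg := diff_unique (diff_continuous df) E.
  by apply/diff_locallyP; split; rewrite dg //; exact: diff_continuous.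
apply/eqaddoP => e e0.
have /diff_locallyP[_ /eqaddoP /(_ e e0)] := df.
apply: filterS2; last first.
  move: fg; rewrite -{1}[x]add0r (near_shift 0) /= => fg.
  exact: fg.
move=> y /= fgy; rewrite !(add0r, subr0) in fgy.
rewrite -[(f \o _ - _) y]/(f (y + x) - (f x + 'd f x y)).
rewrite -[(g \o _ - _) y]/(g (y + x) - (g x + 'd f x y)).

by rewrite fgy (nbhs_singleton fg).
Qed.

Lemma near_eq_continuous V W (f g : V -> W) (x : V) :
  (\near x, f x = g x) -> {for x, continuous f} -> {for x, continuous g}.
Proof.
move=> fg cf; rewrite /prop_for /continuous_at -(nbhs_singleton fg).
exact: (cvg_trans (near_eq_cvg fg) cf).
Qed.

Lemma open_near V (U : set V) (x : V) (P : V -> Prop) :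
  open U -> U x -> (forall y, U y -> P y) -> \forall y \near x, P y.
Proof.
move=> oU Ux UP; have := open_nbhs_nbhs (conj oU Ux).
by apply: filterS.
Qed.

(** Derivatives at a point of the open set U see only values in U. This allows a function to be
    replaced by a formula valid on U alone, as chart expressions are. *)
Lemma eq_Cr_on V W r (U : set V) (f g : V -> W) : open U ->
  (forall x, U x -> f x = g x) -> Cr_on r U f -> Cr_on r U g.
Proof.
move=> oU; elim: r f g => [|r IH] f g fg /=.
  move=> cf x Ux; apply: near_eq_continuous (cf x Ux).
  exact: (open_near oU Ux).
move=> [df Df]; split.
  move=> x Ux; apply: near_eq_differentiable (df x Ux).
  exact: (open_near oU Ux).
move=> v; apply: IH (Df v) => x Ux.
by apply: near_eq_derive; exact: (open_near oU Ux).
Qed.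

Lemma Cr_onW V W r (U : set V) (f : V -> W) : Cr_on r.+1 U f -> Cr_on r U f.
Proof.
elim: r f => [|r IH] f.
  by move=> [df _] x Ux; exact/differentiable_continuous/df.
by move=> [df Df]; split=> // v; exact/IH/Df.
Qed.

Lemma Cr_on_sub V W r (U U' : set V) (f : V -> W) :
  U' `<=` U -> Cr_on r U f -> Cr_on r U' f.
Proof.
move=> sU; elim: r f => [|r IH] f /=; first by move=> cf x /sU; exact: cf.
by move=> [df Df]; split=> [x /sU|v]; [exact: df|exact/IH/Df].
Qed.

Lemma Cr_on_cst V W r (U : set V) (a : W) : Cr_on r U (cst a).
Proof.
elim: r a => [|r IH] a /=; first by move=> x _; exact: cst_continuous.
split=> [x _|v]; first exact: differentiable_cst.
have -> : (fun x => 'D_v (cst a) x) = cst (0 : W) by apply/funext => x; exact: derive_cst.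
exact: IH.
Qed.

Lemma Cr_onD V W r (U : set V) (f g : V -> W) : open U ->
  Cr_on r U f -> Cr_on r U g -> Cr_on r U (fun x => f x + g x).
Proof.
move=> oU; elim: r f g => [|r IH] f g /=.
  by move=> cf cg x Ux; apply: continuousD; [exact: cf|exact: cg].
move=> [df Df] [dg Dg]; split=> [x Ux|v].
  by apply: differentiableD; [exact: df|exact: dg].
apply: (eq_Cr_on oU _ (IH _ _ (Df v) (Dg v))) => x Ux.
by rewrite deriveD //; apply: diff_derivable; [exact: df|exact: dg].
Qed.

Lemma Cr_on_sum V W r (U : set V) (I : Type) (s : seq I) (F : I -> V -> W) :
  open U -> (forall i, Cr_on r U (F i)) ->
  Cr_on r U (fun x => \sum_(i <- s) F i x).
Proof.
move=> oU sF; elim: s => [|i s IH].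
  by apply: (eq_Cr_on oU _ (@Cr_on_cst V W r U 0)) => x _; rewrite big_nil.
apply: (eq_Cr_on oU _ (Cr_onD oU (sF i) IH)) => x _.
by rewrite big_cons.
Qed.

Lemma Cr_onM V r (U : set V) (f g : V -> R^o) : open U ->
  Cr_on r U f -> Cr_on r U g -> Cr_on r U (fun x => f x * g x : R^o).
Proof.
move=> oU; elim: r f g => [|r IH] f g.
  move=> cf cg x Ux.
  by apply: (@continuousM R V f g); [exact: cf|exact: cg].
move=> Cf Cg; have [df Df] := Cf; have [dg Dg] := Cg; split=> [x Ux|v].
  by apply: differentiableM; [exact: df|exact: dg].
(* The Leibniz rule keeps one factor underived, so that factor must first be demoted from order r.+1
   to r. *)
apply: (eq_Cr_on oU _ (Cr_onD oU (IH _ _ (Cr_onW Cf) (Dg v)) (IH _ _ (Cr_onW Cg) (Df v)))) => x Ux.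
rewrite -[RHS]/('D_v (f * g) x) deriveM //; apply: diff_derivable; [exact: df|exact: dg].
Qed.

Lemma Cr_onZl V W r (U : set V) (f : V -> R^o) (a : W) : open U ->
  Cr_on r U f -> Cr_on r U (fun x => f x *: a).
Proof.
move=> oU; elim: r f => [|r IH] f.
  by move=> cf x Ux; apply: continuousZr_tmp; exact: cf.
move=> [df Df]; split=> [x Ux|v]; first by apply: differentiableZl; exact: df.
apply: (eq_Cr_on oU _ (IH _ (Df v))) => x Ux.
rewrite !deriveE; first by rewrite diffZl //; exact: df.
  by apply: differentiableZl; exact: df.
exact: df.
Qed.


Lemma Cr_on_row V n r (U : set V) (f : V -> 'rV[R]_n) : open U ->
  (forall j, Cr_on r U (fun x => f x 0 j : R^o)) -> Cr_on r U f.
Proof.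
move=> oU Cf; apply: (eq_Cr_on oU _ (Cr_on_sum (index_enum _) oU
  (fun j : 'I_n => @Cr_onZl V 'rV[R]_n r U (fun x => f x 0 j) (delta_mx 0 j) oU (Cf j)))).
by move=> x Ux; rewrite -row_sum_delta.
Qed.

Lemma derive_coord V n (f : V -> 'rV[R]_n) (x v : V) j : differentiable f x ->
  'D_v (fun y => f y 0 j : R^o) x = ('D_v f x) 0 j.
Proof.
by move=> df; rewrite derive_mx ?mxE //; exact: diff_derivable.
Qed.

Lemma differentiable_row_coord V n (f : V -> 'rV[R]_n) (x : V) j :
  differentiable f x -> differentiable (fun y => f y 0 j : R^o) x.
Proof.
move=> df; apply: (@differentiable_comp _ _ _ _ f (fun M : 'rV[R]_n => M 0 j : R^o)) => //.
exact: differentiable_coord.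
Qed.

Lemma Cr_on_coord V n r (U : set V) (f : V -> 'rV[R]_n) j : open U ->
  Cr_on r U f -> Cr_on r U (fun x => f x 0 j : R^o).
Proof.
move=> oU; elim: r f => [|r IH] f.
  move=> cf x Ux; apply: (@continuous_comp _ _ _ f (fun M : 'rV[R]_n => M 0 j : R^o)).
    exact: cf.
  exact: coord_continuous.
move=> [df Df]; split=> [x Ux|v]; first exact/differentiable_row_coord/df.
apply: (eq_Cr_on oU _ (IH _ (Df v))) => x Ux.
by rewrite derive_coord //; exact: df.
Qed.

(** The chain rule is written with derivatives of g along the fixed basis directions because [Cr_on]
    speaks only of derivatives along a constant vector; this makes the induction of [Cr_on_comp]
    possible. *)
Lemma derive_comp_row V n (f : V -> 'rV[R]_n) (g : 'rV[R]_n -> R^o) (x v : V) :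
  differentiable f x -> differentiable g (f x) ->
  'D_v (g \o f) x = \sum_j ('D_v f x) 0 j * 'D_(delta_mx 0 j) g (f x).
Proof.
move=> df dg; rewrite deriveE; last exact: differentiable_comp.
rewrite diff_comp //= -(deriveE _ df) {1}['D_v f x]row_sum_delta linear_sum.
by apply: eq_bigr => j _; rewrite (deriveE _ dg); exact: linearZ.
Qed.

Lemma Cr_on_comp V n r (U : set V) (U' : set 'rV[R]_n) (f : V -> 'rV[R]_n)
    (g : 'rV[R]_n -> R^o) : open U -> open U' ->
  (forall x, U x -> U' (f x)) -> Cr_on r U f -> Cr_on r U' g ->
  Cr_on r U (g \o f).
Proof.
move=> oU oU' fU; elim: r f fU g => [|r IH] f fU g.
  by move=> cf cg x Ux; apply: continuous_comp; [exact: cf|exact/cg/fU].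
move=> Cf [dg Dg]; have [df Df] := Cf; split=> [x Ux|v].
  by apply: differentiable_comp; [exact: df|exact/dg/fU].
apply: (eq_Cr_on oU (f := fun x => \sum_j ('D_v f x) 0 j * 'D_(delta_mx 0 j) g (f x))).
  by move=> x Ux; rewrite derive_comp_row //; [exact: df|exact/dg/fU].
apply: Cr_on_sum => // j; apply: Cr_onM => //.
  exact: (Cr_on_coord _ oU (Df v)).
exact: (IH f fU _ (Cr_onW Cf) (Dg (delta_mx 0 j))).
Qed.

Lemma linear_derive V W (f : {linear V -> W}) (x v : V) : 'D_v f x = f v.
Proof.
apply/lim_near_cst => //=.
near=> h.
have h0 : h != 0 by near: h; exact: nbhs_dnbhs_neq.
by rewrite (linearD f) addrK linearZ scalerA mulVf // scale1r.
Unshelve. all: by end_near. Qed.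

Lemma Cr_on_linear V W r (U : set V) (f : {linear V -> W}) : continuous f ->
  Cr_on r U f.
Proof.
move=> cf; case: r => [|r]; first by move=> x _; exact: cf.
split=> [x _|v]; first exact: linear_differentiable.
have -> : (fun x => 'D_v f x) = cst (f v) by apply/funext => x; exact: linear_derive.
exact: Cr_on_cst.
Qed.

Lemma row_coord_Cr_on n r (U : set 'rV[R]_n) j :
  Cr_on r U (fun y : 'rV[R]_n => y 0 j : R^o).
Proof.
have @f : {linear 'rV[R]_n -> R^o}.
  by exists (fun N : 'rV[R]_n => N 0 j); do 2![eexists]; do ?[constructor];
     rewrite ?mxE// => ? *; rewrite ?mxE//; move=> ?; rewrite !mxE.
by apply: (@Cr_on_linear _ _ r U f); exact: coord_continuous.
Qed.

Lemma derive_comp_affine V V' W (f : V' -> W) (a : V -> V') (x v : V) (w : V') :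
  (forall t : R, a (t *: v + x) = t *: w + a x) ->
  'D_v (f \o a) x = 'D_w f (a x).
Proof. by move=> aw; rewrite /derive /=; under eq_fun do rewrite aw. Qed.

(** ['D_v] sees a function only along the line through x in direction v. This serves to compare
    functions that agree on vertical lines but not on a neighbourhood. *)
Lemma eq_derive_line V W (f g : V -> W) (x v : V) :
  (\forall t \near (0 : R), f (t *: v + x) = g (t *: v + x)) ->
  'D_v f x = 'D_v g x.
Proof.
move=> fg; have fgx : f x = g x.
  by have := nbhs_singleton fg; rewrite scale0r add0r.
have E : \forall t \near (0 : R)^',
    t^-1 *: (f (t *: v + x) - f x) = t^-1 *: (g (t *: v + x) - g x).
  by apply: cvg_within; near=> t; rewrite fgx (near fg).
rewrite /derive; congr (lim _); rewrite eqEsubset; split; apply: near_eq_cvg => //.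
by apply: filterS E => t ->.
Unshelve. all: by end_near. Qed.


Lemma is_derive_bigsum V W (I : Type) (s : seq I) (F : I -> V -> W) (dF : I -> W) (x v : V) :
  (forall i, is_derive x v (F i) (dF i)) ->
  is_derive x v (fun z => \sum_(i <- s) F i z) (\sum_(i <- s) dF i).
Proof.
move=> FdF; elim: s => [|i s IH].
  have -> : (fun z => \sum_(i <- [::]) F i z) = cst (0 : W).
    by apply/funext => z; rewrite big_nil.
  by rewrite big_nil; exact: is_derive_cst.
have -> : (fun z => \sum_(j <- i :: s) F j z) = F i + (fun z => \sum_(j <- s) F j z).
  by apply/funext => z; rewrite big_cons.
by rewrite big_cons; exact: is_deriveD.
Qed.

Lemma open_line V (U : set V) (x v : V) : open U -> U x ->
  \forall t \near (0 : R), U (t *: v + x).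
Proof.
move=> oU Ux.
have : (fun t : R => t *: v + x) @ (0 : R) --> x.
  rewrite -[X in _ --> X]add0r -(scale0r v).
  by apply: cvgD; [apply: cvgZr_tmp; exact: cvg_id|exact: cvg_cst].
by apply; exact: open_nbhs_nbhs.
Qed.

(* The mean value theorem is applied in direction u, then in direction v. *)
Lemma second_difference V (U : set V) (f : V -> R^o) (x u v : V) : 
  open U -> U x -> Cr_on 2 U f ->
  \forall t \near (0 : R)^'+, exists a b : R,
    [/\ 0 <= a <= t, 0 <= b <= t &
     f (t *: v + (t *: u + x)) - f (t *: u + x) - (f (t *: v + x) - f x) =
     t ^+ 2 * 'D_v ('D_u f) (b *: v + (a *: u + x))].
Proof.
move=> oU Ux [df Df].
have dline (g : V -> R^o) (y w : V) (s : R) : differentiable g (s *: w + y) ->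
    is_derive s (1 : R^o) (fun s : R^o => g (s *: w + y) : R^o) ('D_w g (s *: w + y)).
  move=> dg; have E : (fun s0 : R^o => g (s0 *: w + y) : R^o) = g \o (fun s0 : R^o => s0 *: w + y) by [].
  have aff : forall t : R, (fun s0 : R^o => s0 *: w + y) (t *: (1 : R^o) + s) = t *: w + (s *: w + y).
    by move=> t /=; rewrite scalerDl [t *: 1]mulr1 addrA.
  have da : differentiable (fun s0 : R^o => s0 *: w + y) s by [].
  rewrite E; apply: DeriveDef.
    by apply: diff_derivable; apply: differentiable_comp.
  exact: (derive_comp_affine _ aff).
have mvt (g dg : R -> R) (t : R) : 0 < t ->
    (forall s, 0 <= s <= t -> is_derive s (1 : R^o) (g : R^o -> R^o) (dg s)) ->
    exists2 c, 0 <= c <= t & g t - g 0 = t * dg c.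
  move=> t0 Dg.
  have [||c ct ->] := @MVT R g dg 0 t t0.
  - by move=> s; rewrite in_itv /= => /andP[s0 st]; apply: Dg; rewrite !ltW.
  - apply: derivable_within_continuous => s; rewrite in_itv /= => s0t.
    by have [] := Dg s s0t.
  by exists c; [move: ct; rewrite in_itv /= => /andP[*]; rewrite !ltW|rewrite subr0 mulrC].
have /nbhs_ballP[e /= e0 eU] : nbhs x U by exact: open_nbhs_nbhs.
have d0 : 0 < `|v| + `|u| + 1 by rewrite ltr_wpDl // addr_ge0.
near=> t.
have t0 : 0 < t by near: t; exact: nbhs_right_gt.
have te : t < e / (`|v| + `|u| + 1).
  by near: t; apply: nbhs_right_lt; rewrite divr_gt0.
have Ut : forall a b : R, 0 <= a <= t -> 0 <= b <= t -> U (b *: v + (a *: u + x)).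
  move=> a b /andP[a0 at_] /andP[b0 bt]; apply: eU.
  rewrite -ball_normE /= addrA opprD addrCA subrr addr0 normrN.
  apply: le_lt_trans (ler_normD _ _) _; rewrite !normrZ !ger0_norm //.
  rewrite ltr_pdivlMr // in te; apply: le_lt_trans te.
  rewrite !mulrDr mulr1 -[leLHS]addr0.
  by rewrite lerD // ?lerD // ?ler_wpM2r // ltW.
have t00 : 0 <= (0 : R) <= t by rewrite lexx ltW.
have ttt : 0 <= t <= t by rewrite lexx ltW.
pose F := fun s : R => f (t *: v + (s *: u + x)) - f (s *: u + x) : R.
pose dF := fun s : R => 'D_u f (t *: v + (s *: u + x)) - 'D_u f (s *: u + x) : R.
have [s s0t|a a0t Fa] := mvt F dF t t0.
  have Us b : 0 <= b <= t -> U (b *: v + (s *: u + x)) by exact: Ut.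
  apply: is_deriveB.
    have -> : (fun s : R^o => f (t *: v + (s *: u + x)) : R^o) =
              (fun s : R^o => f (s *: u + (t *: v + x)) : R^o).
      by apply/funext => s'; rewrite addrCA.
    rewrite addrCA; apply: dline; apply: df; rewrite addrCA; exact: Us.
  by apply: dline; apply: df; have := Us 0 t00; rewrite scale0r add0r.
pose G := fun s : R => 'D_u f (s *: v + (a *: u + x)) : R.
have [s s0t|b b0t Gb] := mvt G (fun s => 'D_v ('D_u f) (s *: v + (a *: u + x))) t t0.
  by apply: dline; apply: (Df u).1; exact: Ut.
exists a, b; split => //.
rewrite /F /G /dF /= !(scale0r, add0r) in Fa Gb.
by rewrite Fa Gb mulrA -expr2.
Unshelve. all: by end_near. Qed.

(** The intermediate point given by the mean value theorem is within t (|v| + |u|) of x, so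
    continuity of the mixed derivative yields the limit. *)
Lemma second_difference_cvg V (U : set V) (f : V -> R^o) (x u v : V) :
  open U -> U x -> Cr_on 2 U f ->
  ((f (t *: v + (t *: u + x)) - f (t *: u + x) - (f (t *: v + x) - f x)) / t ^+ 2
     @[t --> (0 : R)^'+]) --> 'D_v ('D_u f) x.
Proof.
move=> oU Ux C2; have [_ Df] := C2; have [_ DDf] := Df u.
have cD : {for x, continuous ('D_v ('D_u f))} by apply: DDf.
apply/cvgrPdist_lt => e e0.
move/cvgrPdist_lt: cD => /(_ e e0) /nbhs_ballP[d /= d0 dD].
have n0 : 0 < `|v| + `|u| + 1 by rewrite ltr_wpDl // addr_ge0.
near=> t.
have t0 : 0 < t by near: t; exact: nbhs_right_gt.
have td : t < d / (`|v| + `|u| + 1).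
  by near: t; apply: nbhs_right_lt; rewrite divr_gt0.
have : exists a b : R,
    [/\ 0 <= a <= t, 0 <= b <= t &
     f (t *: v + (t *: u + x)) - f (t *: u + x) - (f (t *: v + x) - f x) =
     t ^+ 2 * 'D_v ('D_u f) (b *: v + (a *: u + x))].
  by near: t; exact: second_difference C2.
move=> [a [b [/andP[a0 at_] /andP[b0 bt] ->]]].
rewrite mulrAC divff ?mul1r; last by rewrite expf_neq0 // gt_eqF.
apply: dD; rewrite -ball_normE /= addrA opprD addrCA subrr addr0 normrN.
apply: le_lt_trans (ler_normD _ _) _; rewrite !normrZ !ger0_norm //.
rewrite ltr_pdivlMr // in td; apply: le_lt_trans td.
rewrite !mulrDr mulr1 -[leLHS]addr0.
by rewrite lerD // ?lerD // ?ler_wpM2r // ltW.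
Unshelve. all: by end_near. Qed.

(** The second difference is symmetric in u and v, and both mixed derivatives are its limit. *)
Lemma deriveC V (U : set V) (f : V -> R^o) (x u v : V) :
  open U -> U x -> Cr_on 2 U f -> 'D_v ('D_u f) x = 'D_u ('D_v f) x.
Proof.
move=> oU Ux C2.
have /cvg_lim <- // := second_difference_cvg (u := u) (v := v) oU Ux C2.
have /cvg_lim <- // := second_difference_cvg (u := v) (v := u) oU Ux C2.
apply: (congr1 (fun h : R -> R^o => lim (h @ (0 : R)^'+))); apply/funext => t; congr (_ / _).
rewrite [t *: v + (t *: u + x)]addrCA !opprB addrACA [RHS]addrACA; congr (_ + _).
by rewrite addrC.
Qed.

End Smoothness.

(** * Iterated derivatives and multi-indices *)

Section SmoothOn.
Context {R : realType}.
Implicit Types V W : normedModType R.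

Lemma smooth_on_derive V W (U : set V) (f : V -> W) (v : V) :
  smooth_on U f -> smooth_on U ('D_v f).
Proof. by move=> sf r; have [_] := sf r.+1; exact. Qed.

Lemma smooth_on_differentiable V W (U : set V) (f : V -> W) x :
  smooth_on U f -> U x -> differentiable f x.
Proof. by move=> sf Ux; have [df _] := sf 1; exact: df. Qed.

Lemma eq_smooth_on V W (U : set V) (f g : V -> W) : open U ->
  (forall x, U x -> f x = g x) -> smooth_on U f -> smooth_on U g.
Proof. by move=> oU fg sf r; exact: eq_Cr_on (sf r). Qed.

Lemma smooth_on_sub V W (U U' : set V) (f : V -> W) :
  U' `<=` U -> smooth_on U f -> smooth_on U' f.
Proof. by move=> sU sf r; exact: Cr_on_sub (sf r). Qed.

Lemma smooth_on_sum V W (U : set V) (I : Type) (s : seq I) (F : I -> V -> W) :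
  open U -> (forall i, smooth_on U (F i)) ->
  smooth_on U (fun x => \sum_(i <- s) F i x).
Proof. by move=> oU sF r; apply: Cr_on_sum => // i; exact: sF. Qed.

Lemma smooth_onD V W (U : set V) (f g : V -> W) : open U ->
  smooth_on U f -> smooth_on U g -> smooth_on U (fun x => f x + g x).
Proof. by move=> oU sf sg r; exact: Cr_onD. Qed.

Lemma smooth_onM V (U : set V) (f g : V -> R^o) : open U ->
  smooth_on U f -> smooth_on U g -> smooth_on U (fun x => f x * g x : R^o).
Proof. by move=> oU sf sg r; exact: Cr_onM. Qed.

Lemma smooth_on_coord V n (U : set V) (f : V -> 'rV[R]_n) j : open U ->
  smooth_on U f -> smooth_on U (fun x => f x 0 j : R^o).
Proof. by move=> oU sf r; exact: Cr_on_coord. Qed.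

Lemma smooth_on_row V n (U : set V) (f : V -> 'rV[R]_n) : open U ->
  (forall j, smooth_on U (fun x => f x 0 j : R^o)) -> smooth_on U f.
Proof. by move=> oU sf r; apply: Cr_on_row => // j; exact: sf. Qed.

Lemma smooth_on_comp V n (U : set V) (U' : set 'rV[R]_n) (f : V -> 'rV[R]_n)
    (g : 'rV[R]_n -> R^o) : open U -> open U' ->
  (forall x, U x -> U' (f x)) -> smooth_on U f -> smooth_on U' g ->
  smooth_on U (g \o f).
Proof. by move=> oU oU' fU sf sg r; exact: Cr_on_comp (sf r) (sg r). Qed.

Lemma eq_derive_on V W (U : set V) (f g : V -> W) (x v : V) : open U -> U x ->
  (forall y, U y -> f y = g y) -> 'D_v f x = 'D_v g x.
Proof. by move=> oU Ux fg; apply: near_eq_derive; exact: open_near fg. Qed.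

Section IteratedDerivatives.
Context {m : nat}.
Implicit Types (U : set 'rV[R]_m) (f g : 'rV[R]_m -> R^o) (s : seq 'I_m).

(** The same [foldr] as in [jcrd], so that the fibre coordinates of a jet are [iterD] by conversion.
    The head of s is the outermost derivative. *)
Definition iterD s f : 'rV[R]_m -> R^o :=
  foldr (fun i (g : 'rV[R]_m -> R^o) => 'D_(delta_mx 0 i) g) f s.

Lemma smooth_on_iterD U s f : smooth_on U f -> smooth_on U (iterD s f).
Proof. by move=> sf; elim: s => //= i s IH; exact: smooth_on_derive. Qed.

Lemma eq_iterD U s f g : open U -> (forall x, U x -> f x = g x) ->
  forall x, U x -> iterD s f x = iterD s g x.
Proof.
move=> oU fg; elim: s => [|i s IH] x Ux /=; first exact: fg.
exact: eq_derive_on IH.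
Qed.

Lemma iterD_cat s s' f : iterD (s ++ s') f = iterD s (iterD s' f).
Proof. by rewrite /iterD foldr_cat. Qed.

Lemma iterD_deriveC U s i f : open U -> smooth_on U f ->
  forall x, U x -> iterD s ('D_(delta_mx 0 i) f) x = 'D_(delta_mx 0 i) (iterD s f) x.
Proof.
move=> oU sf; elim: s => //= j s IH x Ux.
rewrite (eq_derive_on _ oU Ux IH); apply: (deriveC _ _ oU Ux).
exact: (smooth_on_iterD s sf 2%N).
Qed.

(** [mi_seq] lists indices in increasing order, so [i :: mi_seq J] is the list of J + 1_i only up to
    a permutation. *)
Lemma perm_iterD U s s' f : open U -> smooth_on U f -> perm_eq s s' ->
  forall x, U x -> iterD s f x = iterD s' f x.
Proof.
move=> oU sf; elim: s s' => [|i s IH] s'.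
  by rewrite perm_sym => /perm_nilP ->.
move=> pss'; have : i \in s' by rewrite -(perm_mem pss') mem_head.
move=> is'; move: pss'; case/path.splitPr: is' => s1 s2 pss'.
have {}pss' : perm_eq s (s1 ++ s2).
  by rewrite -(perm_cons i); apply: (perm_trans pss'); rewrite -cat1s perm_catCA.
move=> x Ux; rewrite iterD_cat /= (iterD_deriveC _ _ oU) //; last exact: smooth_on_iterD.
rewrite -iterD_cat; exact: (eq_derive_on _ oU Ux (IH _ pss')).
Qed.

Lemma iterD_sum U s (I : Type) (r : seq I) (F : I -> 'rV[R]_m -> R^o) :
  open U -> (forall i, smooth_on U (F i)) ->
  forall x, U x ->
    iterD s (fun y => \sum_(i <- r) F i y) x = \sum_(i <- r) iterD s (F i) x.
Proof.
move=> oU sF; elim: s => //= j s IH x Ux.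
rewrite (eq_derive_on _ oU Ux IH).
elim: r {IH} => [|i r IHr].
  have -> : (fun y : 'rV[R]_m => \sum_(i <- [::]) iterD s (F i) y) = cst (0 : R^o).
    by apply/funext => y; rewrite big_nil.
  by rewrite big_nil derive_cst.
rewrite big_cons -IHr.
have -> : (fun y : 'rV[R]_m => \sum_(i <- i :: r) iterD s (F i) y) =
   iterD s (F i) + (fun y => \sum_(i <- r) iterD s (F i) y).
  by apply/funext => y; rewrite big_cons.
rewrite deriveD //; apply: diff_derivable; apply: (smooth_on_differentiable (U := U)) => //.
  exact: smooth_on_iterD.
by apply: smooth_on_sum => // i'; exact: smooth_on_iterD.
Qed.

Lemma iterDD U s f g : open U -> smooth_on U f -> smooth_on U g ->
  forall x, U x -> iterD s (fun y => f y + g y) x = iterD s f x + iterD s g x.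
Proof.
move=> oU sf sg; elim: s => //= j s IH x Ux.
rewrite (eq_derive_on _ oU Ux IH).
rewrite -[LHS]/('D_(delta_mx 0 j) (iterD s f + iterD s g) x) deriveD //;
  apply: diff_derivable; apply: (smooth_on_differentiable (U := U)) => //;
  exact: smooth_on_iterD.
Qed.

Lemma iterDZ U s (a : R) f : open U -> smooth_on U f ->
  forall x, U x -> iterD s (fun y => a * f y : R^o) x = a * iterD s f x.
Proof.
move=> oU sf; elim: s => //= j s IH x Ux.
rewrite (eq_derive_on _ oU Ux IH).
rewrite -[LHS]/('D_(delta_mx 0 j) (a *: iterD s f) x) deriveZ //.
apply: diff_derivable; apply: (smooth_on_differentiable (U := U)) => //.
exact: smooth_on_iterD.
Qed.

Lemma iterD0 s (x : 'rV[R]_m) : iterD s (cst 0) x = 0.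
Proof.
elim: s x => //= j s IH x; have -> : iterD s (cst 0) = cst 0 by apply/funext.
exact: derive_cst.
Qed.

End IteratedDerivatives.
End SmoothOn.

Section MultiIndices.
Context {m : nat}.
Implicit Types (i : 'I_m) (s : seq 'I_m).

Lemma mi_fun_le r (J : mi m r) : (\sum_(i < m) mi_fun J i <= r)%N.
Proof. exact: (valP J). Qed.

Lemma mi_fun_inj r (J K : mi m r) : mi_fun J =1 mi_fun K -> J = K.
Proof. by move=> JK; apply/val_inj/ffunP => i; apply/val_inj; exact: JK. Qed.

Lemma mi_inK r (J : 'I_m -> nat) : (\sum_(i < m) J i <= r)%N ->
  mi_fun (mi_in r J) =1 J.
Proof.
move=> Jr i; rewrite /mi_fun /mi_in.
(* Both [inord] and [insubd] have default values; the bound on the sum excludes the default in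
   each. *)
have Ji j : (J j < r.+1)%N.
  by rewrite ltnS (leq_trans _ Jr) // (bigD1 j) //= leq_addr.
by rewrite insubdK ?ffunE ?inordK // unfold_in (eq_bigr J) // => j _; rewrite ffunE inordK.
Qed.

Lemma mi_in_fun r l (J : mi m l) : (mi_norm J <= r)%N -> mi_fun (mi_in r (mi_fun J)) =1 mi_fun J.
Proof. exact: mi_inK. Qed.

Lemma mi_funK r (J : mi m r) : mi_in r (mi_fun J) = J.
Proof. by apply: mi_fun_inj; apply: mi_inK; exact: mi_fun_le. Qed.

Lemma sum_succ (J : 'I_m -> nat) i :
  (\sum_(j < m) (J j + (j == i)) = (\sum_(j < m) J j).+1)%N.
Proof.
rewrite big_split /= (bigD1 (P := xpredT) (F := fun j => nat_of_bool (j == i)) i) //= eqxx.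
by rewrite [X in (_ + (_ + X))%N]big1 ?addn0 ?addn1 // => j /negbTE ->.
Qed.

Lemma mi_succE r (J : mi m r) i j : mi_fun (mi_succ J i) j = (mi_fun J j + (j == i))%N.
Proof. by rewrite /mi_succ mi_inK // sum_succ ltnS mi_fun_le. Qed.

Lemma count_mi_seq r (J : mi m r) i : count_mem i (mi_seq J) = mi_fun J i.
Proof.
rewrite /mi_seq count_flatten -map_comp sumnE big_map big_enum /=.
rewrite (bigD1 i) //= count_nseq /= eqxx mul1n big1 ?addn0 // => j /negbTE ji.
by rewrite count_nseq /= ji.
Qed.

Lemma size_mi_seq r (J : mi m r) : size (mi_seq J) = mi_norm J.
Proof.
rewrite /mi_seq size_flatten /shape -map_comp sumnE big_map big_enum /=.
by apply: eq_bigr => j _; rewrite size_nseq.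
Qed.

Lemma perm_count_mem s s' : (forall i, count_mem i s = count_mem i s') -> perm_eq s s'.
Proof. by move=> ss'; apply/allP => i _; apply/eqP; exact: ss'. Qed.

Lemma eq_mi_seq r l (J : mi m r) (K : mi m l) : mi_fun J =1 mi_fun K -> mi_seq J = mi_seq K.
Proof.
by move=> JK; rewrite /mi_seq; congr flatten; apply: eq_map => i; rewrite JK.
Qed.

Lemma perm_mi_succ r (J : mi m r) i : perm_eq (mi_seq (mi_succ J i)) (i :: mi_seq J).
Proof.
apply: perm_count_mem => j; rewrite count_mi_seq mi_succE /= count_mi_seq addnC.
by rewrite eq_sym.
Qed.

Lemma sum_count_mem s : (\sum_(i < m) count_mem i s)%N = size s.
Proof.
elim: s => [|j s IH] /=; first by rewrite big1.
rewrite big_split /= IH (bigD1 j) //= eqxx big1 ?addn0 // => i ij.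
by rewrite eq_sym (negbTE ij).
Qed.

Lemma mi_in_count r (J : mi m r) : mi_in r (fun i => count_mem i (mi_seq J)) = J.
Proof.
by rewrite -[RHS]mi_funK; congr mi_in; apply/funext => i; exact: count_mi_seq.
Qed.

End MultiIndices.

(** * Charts *)

Section Charts.
Context {R : realType}.

Lemma smooth_on_comp_row (V : normedModType R) n p (U : set V) (U' : set 'rV[R]_n)
    (f : V -> 'rV[R]_n) (g : 'rV[R]_n -> 'rV[R]_p) : open U -> open U' ->
  (forall x, U x -> U' (f x)) -> smooth_on U f -> smooth_on U' g ->
  smooth_on U (g \o f).
Proof.
move=> oU oU' fU sf sg; apply: smooth_on_row => // j.
exact: (@smooth_on_comp _ _ _ _ _ f (fun x => g x 0 j : R^o) oU oU' fU sf (smooth_on_coord j oU' sg)).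
Qed.

Lemma smooth_on_continuous (V W : normedModType R) (U : set V) (f : V -> W) x :
  smooth_on U f -> U x -> {for x, continuous f}.
Proof. by move=> sf; exact: (sf 0%N). Qed.

Lemma smooth_on_id n (U : set 'rV[R]_n) : smooth_on U (id : 'rV[R]_n -> 'rV[R]_n).
Proof. by move=> r; apply: (@Cr_on_linear _ _ _ r U idfun) => x; exact: cvg_id. Qed.

Lemma smooth_on_cst (V W : normedModType R) (U : set V) (a : W) : smooth_on U (fun=> a).
Proof. by move=> r; exact: Cr_on_cst. Qed.

Lemma smooth_row_coord n (U : set 'rV[R]_n) j :
  smooth_on U (fun y : 'rV[R]_n => y 0 j : R^o).
Proof. by move=> r; exact: row_coord_Cr_on. Qed.

Lemma smooth_on_rowmx (V : normedModType R) (U : set V) p q (f : V -> 'rV[R]_p)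
    (g : V -> 'rV[R]_q) : open U -> smooth_on U f -> smooth_on U g ->
  smooth_on U (fun x => row_mx (f x) (g x)).
Proof.
move=> oU sf sg; apply: smooth_on_row => // j; case: (split_ordP j) => i ->.
  by apply: (eq_smooth_on oU _ (smooth_on_coord i oU sf)) => y _; rewrite row_mxEl.
by apply: (eq_smooth_on oU _ (smooth_on_coord i oU sg)) => y _; rewrite row_mxEr.
Qed.

Lemma openP (T : topologicalType) (A : set T) :
  (forall x, A x -> \forall y \near x, A y) -> open A.
Proof. by rewrite openE. Qed.

Lemma near_open (T : topologicalType) (A : set T) x : open A -> A x -> \forall y \near x, A y.
Proof. by move=> oA Ax; exact: open_nbhs_nbhs. Qed.

Context {T : topologicalType} {n : nat}.
Implicit Type c : chart R T n.

Lemma cfun_cinv c y : (cfun c @` cdom c) y -> cdom c (cinv c y) /\ cfun c (cinv c y) = y.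
Proof. by case=> x cx <-; rewrite cfunK. Qed.

Lemma cfun_inj c x x' : cdom c x -> cdom c x' -> cfun c x = cfun c x' -> x = x'.
Proof. by move=> cx cx' /(congr1 (cinv c)); rewrite !cfunK. Qed.

(** Within the open range of the chart, the image is the preimage of V under [cinv c], which is
    continuous there. *)
Lemma open_cfun_image c (V : set T) : open V -> V `<=` cdom c -> open (cfun c @` V).
Proof.
move=> oV Vc; apply: openP => _ [x Vx <-].
have cx := Vc _ Vx.
have im : (cfun c @` cdom c) (cfun c x) by exists x.
have : \forall y \near cfun c x, (cfun c @` cdom c) y by exact: (near_open (@crange_open _ _ _ c) im).
have : \forall y \near cfun c x, V (cinv c y).
  by apply: (cinv_cont im); rewrite cfunK //; exact: (near_open oV Vx).
by apply: filterS2 => y Vy /cfun_cinv[cy <-]; exists (cinv c y).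
Qed.

Lemma open_cfun_preimage c (O : set 'rV[R]_n) : open O ->
  open [set x | cdom c x /\ O (cfun c x)].
Proof.
move=> oO; apply: openP => x [cx Ox].
have : \forall y \near x, cdom c y by exact: (near_open (@cdom_open _ _ _ c) cx).
have : \forall y \near x, O (cfun c y) by apply: (cfun_cont cx); exact: (near_open oO Ox).
by apply: filterS2.
Qed.

End Charts.

(** * Taylor monomials and their derivatives at the centre *)

Section Monomials.
Context {R : realType} {m : nat}.
Implicit Types J : 'I_m -> nat.

(** The divided power (y - x)^J / J!, normalised so that its derivatives at x are 0 or 1. *)
Definition monomial (x : 'rV[R]_m) J (y : 'rV[R]_m) : R^o := \prod_i ((y 0 i - x 0 i) ^+ J i / (J i)`!%:R).

Lemma smooth_on_prod (V : normedModType R) (U : set V) (I : Type) (s : seq I)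
    (F : I -> V -> R^o) : open U -> (forall i, smooth_on U (F i)) ->
  smooth_on U (fun x => \prod_(i <- s) F i x : R^o).
Proof.
move=> oU sF; elim: s => [|i s IH].
  apply: (eq_smooth_on oU _ (@smooth_on_cst _ V R^o U 1)) => z _; by rewrite big_nil.
apply: (eq_smooth_on oU _ (smooth_onM oU (sF i) IH)) => z _; by rewrite big_cons.
Qed.

Lemma smooth_onX (V : normedModType R) (U : set V) (f : V -> R^o) k :
  open U -> smooth_on U f -> smooth_on U (fun x => f x ^+ k : R^o).
Proof.
move=> oU sf; apply: (eq_smooth_on oU _ (smooth_on_prod (index_enum 'I_k) oU (fun=> sf))).
by move=> x _; rewrite prodr_const card_ord.
Qed.

Lemma smooth_monomial (x : 'rV[R]_m) J : smooth_on setT (monomial x J).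
Proof.
have oT : open [set: 'rV[R]_m] by exact: openT.
apply: smooth_on_prod => // i; apply: smooth_onM => //; last exact: smooth_on_cst.
apply: smooth_onX => //; apply: smooth_onD => //; last exact: smooth_on_cst.
exact: smooth_row_coord.
Qed.

(** The case J i = 0 is separate because the truncated subtraction would return the monomial itself
    instead of 0. *)
Lemma derive_monomial (x : 'rV[R]_m) J (y : 'rV[R]_m) (i : 'I_m) :
  'D_(delta_mx 0 i) (monomial x J) y =
  if J i == 0%N then 0 else monomial x (fun j => J j - (j == i))%N y.
Proof.
(* Along direction i only the i-th factor moves: C collects the others, and F is the resulting
   function of one variable. *)
pose C : R := \prod_(j < m | j != i) ((y 0 j - x 0 j) ^+ J j / (J j)`!%:R).
pose F : R -> R := fun s => C * (s ^+ J i / (J i)`!%:R).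
have line (t : R) (j : 'I_m) : (t *: delta_mx 0 i + y) 0 j = (j == i)%:R * t + y 0 j.
  by rewrite !mxE eqxx /= mulrC.
have -> : 'D_(delta_mx 0 i) (monomial x J) y =
    'D_(delta_mx 0 i) (F \o (fun z : 'rV[R]_m => z 0 i - x 0 i : R^o) : _ -> R^o) y.
  apply: eq_derive_line; apply: (@filterE _ (nbhs (0 : R))) => t.
  rewrite /monomial /= /F (bigD1 i) //= mulrC; congr (_ * _).
  by apply: eq_bigr => j /negbTE ji; rewrite line ji mul0r add0r.
rewrite (@derive_comp_affine _ _ _ _ (F : R^o -> R^o) _ _ _ (1 : R^o)); last first.
  by move=> t; rewrite line eqxx mul1r [t *: 1]mulr1 addrA.
have -> : (F : R^o -> R^o) = (C / (J i)`!%:R) *: (@GRing.exp R ^~ (J i) : R^o -> R^o).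
  apply/funext => s; rewrite /F -[RHS]/((C / (J i)`!%:R) * s ^+ J i).
  by rewrite mulrA mulrAC.
rewrite deriveZ; last exact: exprn_derivable.
rewrite exp_derive.
case: (J i =P 0%N) => [->|/eqP Ji0]; first by rewrite mulr0n !scale0r scaler0.
rewrite /monomial (bigD1 i) //= eqxx subn1.
have -> : \prod_(j < m | j != i) ((y 0 j - x 0 j) ^+ (J j - (j == i)) / (J j - (j == i))`!%:R) = C.
  by apply: eq_bigr => j /negbTE ->; rewrite subn0.
rewrite -[LHS]/((C / (J i)`!%:R) * ((J i)%:R * (y 0 i - x 0 i) ^+ (J i).-1 * 1)).
case: (J i) Ji0 => // k _.
rewrite factS natrM /=.
have k0 : k.+1%:R != 0 :> R by rewrite pnatr_eq0.
have f0 : (k`!)%:R != 0 :> R by rewrite pnatr_eq0 -lt0n fact_gt0.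
move: (k.+1%:R : R) (k`!%:R : R) k0 f0 => a b a0 b0.
by field; rewrite a0 b0.
Qed.

Lemma iterD_monomial (x : 'rV[R]_m) J (s : seq 'I_m) :
  iterD s (monomial x J) x = [forall i, count_mem i s == J i]%:R.
Proof.
elim: s J => [|i s IH] J.
  rewrite /= /monomial; case: forallP => [J0|/forallP].
    by rewrite big1 // => i _; rewrite -(eqP (J0 i)) expr0 fact0 divr1.
  rewrite negb_forall => /existsP[i Ji].
  by rewrite (bigD1 i) //= subrr expr0n eq_sym (negbTE Ji) !mul0r.
have oT : open [set: 'rV[R]_m] by exact: openT.
have sm := smooth_monomial x J.
(* The outermost derivative is moved innermost, where it turns the monomial into another one; the
   induction hypothesis, general in J, knows values at the centre x only. *)
rewrite /= -(iterD_deriveC s i oT sm) //.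
have E : forall y, [set: 'rV[R]_m] y -> 'D_(delta_mx 0 i) (monomial x J) y =
  (if J i == 0%N then cst 0 else monomial x (fun j => J j - (j == i))%N) y.
  by move=> y _; rewrite derive_monomial; case: ifP.
rewrite (eq_iterD _ oT E) //; case: eqP => [Ji0|/eqP Ji0].
  rewrite iterD0; case: forallP => // /(_ i).
  by rewrite Ji0 eqxx.
rewrite IH; congr (nat_of_bool _)%:R; apply: eq_forallb => j.
rewrite [i == j]eq_sym; have [->|ji] := eqVneq j i; last by rewrite add0n subn0.
by case: (J i) Ji0 => // k _; rewrite subn1 add1n eqSS.
Qed.

End Monomials.

(** * Jets *)

Section CoordinateVectors.
Context {R : realType} {T : finType}.
Implicit Types (y v : 'rV[R]_#|T|) (F : T -> R).

Lemma tcrd_tvec F t : tcrd (tvec F) t = F t.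
Proof. by rewrite /tcrd mxE enum_rankK. Qed.

Lemma tcrd_inj y v : (forall t, tcrd y t = tcrd v t) -> y = v.
Proof. by move=> yv; apply/rowP => j; have := yv (enum_val j); rewrite /tcrd enum_valK. Qed.

Lemma tcrdD y v t : tcrd (y + v) t = tcrd y t + tcrd v t.
Proof. by rewrite /tcrd mxE. Qed.

Lemma tcrdZ (a : R) y t : tcrd (a *: y) t = a * tcrd y t.
Proof. by rewrite /tcrd mxE. Qed.

Lemma tcrd_basis t t' : tcrd (tbasis t : 'rV[R]_#|T|) t' = (t' == t)%:R.
Proof. by rewrite /tcrd /tbasis mxE (inj_eq enum_rank_inj). Qed.

Lemma smooth_tcrd (U : set 'rV[R]_#|T|) t : smooth_on U (fun y => tcrd y t : R^o).
Proof. exact: smooth_row_coord. Qed.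

End CoordinateVectors.

Section Jets.
Context {R : realType} {m n : nat} {B : fbundle R m n}.
Implicit Types (c d : fchart B) (x : base B) (phi psi : base B -> total B).

Lemma lsec_proj x phi : lsec x phi -> proj (phi x) = x.
Proof. by case=> /nbhs_singleton. Qed.

Lemma lsec_chart x phi c : lsec x phi -> cdom (fct c) (phi x) -> cdom (fcb c) x.
Proof. by move=> /lsec_proj {2}<- /fc_fibred[]. Qed.

Definition fibre_part c phi (al : 'I_n) : 'rV[R]_m -> R^o :=
  fun y => rsubmx (cfun (fct c) (phi (cinv (fcb c) y))) 0 al.

Lemma jcrd_base r c phi x i : tcrd (jcrd r c phi x) (inl i) = cfun (fcb c) x 0 i.
Proof. exact: tcrd_tvec. Qed.

Lemma jcrd_fibre r c phi x al J :
  tcrd (jcrd r c phi x) (inr (al, J)) =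
  iterD (mi_seq J) (fibre_part c phi al) (cfun (fcb c) x).
Proof. exact: tcrd_tvec. Qed.

Lemma contact_sym r x phi psi : contact r x phi psi -> contact r x psi phi.
Proof. by move=> [e E]; split=> // c; rewrite -e => /E. Qed.

Lemma contact_trans r x phi psi chi :
  contact r x phi psi -> contact r x psi chi -> contact r x phi chi.
Proof. move=> [e E] [e' E']; split; first by rewrite e.
by move=> c cx; rewrite E // E' // -e. Qed.

Lemma contact_refl r x phi : contact r x phi phi.
Proof. by []. Qed.

Lemma jclassE r (z : jet B r) :
  jclass z = [set psi | lsec (jbase z) psi /\ contact r (jbase z) (jrep z) psi].
Proof. exact: (s2valP' (cid2 (jclass_ex z))). Qed.

Lemma jrep_class r (z : jet B r) : jclass z (jrep z).
Proof. by rewrite jclassE; split; [exact: jrep_lsec|exact: contact_refl]. Qed.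

Lemma jrep_jet_at r x phi (h : lsec x phi) : contact r x phi (jrep (jet_at r h)).
Proof. by have [] := jrep_class (jet_at r h). Qed.

(** Contact being an equivalence relation, the two contact classes are equal as sets; the existence
    proofs stored in the jets agree by proof irrelevance. *)
Lemma jet_eq r (z : jet B r) phi (h : lsec (jbase z) phi) :
  contact r (jbase z) (jrep z) phi -> z = jet_at r h.
Proof.
move=> C; have := jclassE z; move: C; move: (jrep z).
case: z h => x S ex /= h psi C; rewrite /jet_at => E.
have {}E : S = [set chi | lsec x chi /\ contact r x phi chi].
  rewrite E; apply/seteqP; split=> chi [hc Hc]; split => //.
    exact: contact_trans (contact_sym C) Hc.
  exact: contact_trans C Hc.
by move: ex; rewrite E => ex; congr Jet; exact: Prop_irrelevance.
Qed.

Lemma jet_eq_base r x (z : jet B r) phi (h : lsec x phi) : jbase z = x ->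
  contact r (jbase z) (jrep z) phi -> z = jet_at r h.
Proof. by move=> zx; move: h; rewrite -zx => h; exact: jet_eq. Qed.

Lemma jtotal_jet_at r x phi (h : lsec x phi) : jtotal (jet_at r h) = phi x.
Proof. by have [] := jrep_jet_at r h. Qed.

Lemma jcrd_jet_at r c x phi (h : lsec x phi) : cdom (fct c) (phi x) ->
  jcrd r c (jrep (jet_at r h)) x = jcrd r c phi x.
Proof. by have [_ E] := jrep_jet_at r h => /E. Qed.

Lemma jtotal_proj r (z : jet B r) : proj (jtotal z) = jbase z.
Proof. exact: lsec_proj (jrep_lsec z). Qed.

Lemma jet_chart r (z : jet B r) c : cdom (fct c) (jtotal z) -> cdom (fcb c) (jbase z).
Proof. by rewrite -jtotal_proj => /fc_fibred[]. Qed.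

(** The projection pi_{r,0} in coordinates. *)
Definition jbottom r (y : 'rV[R]_#|jidx m n r|) : 'rV[R]_(m + n) :=
  row_mx (\row_i tcrd y (inl i)) (\row_al tcrd y (inr (al, mi0 r))).

(** Explicit form of the image of the induced chart on r-jets (see [Jspace_image]): only the
    coordinates of order zero are constrained, which makes openness evident. *)
Definition jdom r c : set 'rV[R]_#|jidx m n r| :=
  [set y | (cfun (fct c) @` cdom (fct c)) (jbottom y)].

Lemma mi0_fun r (i : 'I_m) : mi_fun (mi0 r) i = 0%N.
Proof. by rewrite /mi_fun ffunE. Qed.

Lemma mi_seq0 r : mi_seq (mi0 r : mi m r) = [::].
Proof.
apply: size0nil; rewrite size_mi_seq /mi_norm big1 // => i _.
exact: mi0_fun.
Qed.

Lemma jbottom_jcrd r c phi x : lsec x phi -> cdom (fct c) (phi x) ->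
  jbottom (jcrd r c phi x) = cfun (fct c) (phi x).
Proof.
move=> h cx; have [cb E] := fc_fibred cx.
rewrite -[RHS]hsubmxK /jbottom; congr row_mx; apply/rowP => j; rewrite mxE.
  by rewrite jcrd_base E (lsec_proj h).
rewrite jcrd_fibre mi_seq0 /= /fibre_part cfunK //.
exact: lsec_chart h cx.
Qed.

Lemma smooth_jbottom r : smooth_on setT (@jbottom r).
Proof.
have oT : open [set: 'rV[R]_#|jidx m n r|] by exact: openT.
apply: smooth_on_rowmx => //; apply: smooth_on_row => // j.
  apply: (eq_smooth_on oT _ (@smooth_tcrd R _ setT (inl j : jidx m n r))) => y _; by rewrite mxE.
apply: (eq_smooth_on oT _ (@smooth_tcrd R _ setT (inr (j, mi0 r) : jidx m n r))) => y _; by rewrite mxE.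
Qed.

Lemma open_jdom r c : open (@jdom r c).
Proof.
apply: openP => y; rewrite /jdom /= => Oy.
have cj : {for y, continuous (@jbottom r)}.
  by apply: (smooth_on_continuous (@smooth_jbottom r)).
exact: (cj _ (near_open (@crange_open _ _ _ (fct c)) Oy)).
Qed.

Definition taylor r (a : 'rV[R]_#|jidx m n r|) (al : 'I_n) : 'rV[R]_m -> R^o :=
  fun y => \sum_(J : mi m r) tcrd a (inr (al, J)) *
             monomial (\row_i tcrd a (inl i)) (mi_fun J) y.

Lemma smooth_taylor r (a : 'rV[R]_#|jidx m n r|) al : smooth_on setT (taylor a al).
Proof.
have oT : open [set: 'rV[R]_m] by exact: openT.
apply: smooth_on_sum => // J; apply: smooth_onM => //; first exact: smooth_on_cst.
exact: smooth_monomial.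
Qed.

Lemma iterD_taylor r (a : 'rV[R]_#|jidx m n r|) al (K : mi m r) :
  iterD (mi_seq K) (taylor a al) (\row_i tcrd a (inl i)) = tcrd a (inr (al, K)).
Proof.
have oT : open [set: 'rV[R]_m] by exact: openT.
have sm J : smooth_on setT (monomial (\row_i tcrd a (inl i)) (mi_fun (r := r) J)).
  exact: smooth_monomial.
rewrite /taylor (iterD_sum _ _ oT) //; last first.
  by move=> J; apply: smooth_onM => //; exact: smooth_on_cst.
rewrite (bigD1 K) //= big1 ?addr0 => [|J JK].
  rewrite (iterDZ _ _ oT) // iterD_monomial; case: forallP => [_|[]].
    by rewrite mulr1.
  by move=> i; rewrite count_mi_seq.
rewrite (iterDZ _ _ oT) // iterD_monomial; case: forallP => [KJ|_].
  case/eqP: JK; apply: mi_fun_inj => i.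
  by have /eqP := KJ i; rewrite count_mi_seq.
by rewrite mulr0.
Qed.

(** The local section whose fibre components in c are the Taylor polynomials with coefficients a
    realizes a. Most of the work is its smoothness in the other fibred charts. *)
Lemma jet_exists r c (a : 'rV[R]_#|jidx m n r|) : @jdom r c a ->
  exists z : jet B r, cs_dom c (z : Jspace B r) /\ @cs_crd _ _ _ _ (Jspace B r) c z = a.
Proof.
move=> [e0 ce0 ae0]; have [cx0 Ex0] := fc_fibred ce0.
set x0 := proj e0 in cx0 Ex0.
pose G (y : 'rV[R]_m) : 'rV[R]_(m + n) := row_mx y (\row_al taylor a al y).
have oT : open [set: 'rV[R]_m] by exact: openT.
have sG : smooth_on setT G.
  apply: smooth_on_rowmx => //; first exact: smooth_on_id.
  apply: smooth_on_row => // j; apply: (eq_smooth_on oT _ (smooth_taylor a j)) => y _.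
  by rewrite mxE.
have x0E : cfun (fcb c) x0 = \row_i tcrd a (inl i).
  by rewrite -Ex0 ae0 /jbottom row_mxKl.
have Gx0 : G (cfun (fcb c) x0) = cfun (fct c) e0.
  rewrite ae0 /jbottom /G x0E; congr row_mx; apply/rowP => j; rewrite !mxE.
  by have := iterD_taylor a j (mi0 r); rewrite mi_seq0.
(* This is a section only on [V0] below, where G takes values in the range of [fct c]; [lsec] looks
   only near x0. *)
pose phi x := cinv (fct c) (G (cfun (fcb c) x)).
have phix0 : phi x0 = e0 by rewrite /phi Gx0 cfunK.
pose N (O : set 'rV[R]_(m + n)) := [set x | cdom (fcb c) x /\ O (G (cfun (fcb c) x))].
have oN O : open O -> open (N O).
  move=> oO; apply: (@open_cfun_preimage R _ _ (fcb c) (G @^-1` O)).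
  apply: openP => y Oy; apply: (smooth_on_continuous sG) => //.
  exact: (near_open oO Oy).
pose V0 := N (cfun (fct c) @` cdom (fct c)).
have oV0 : open V0 by apply: oN; exact: crange_open.
have V0x0 : V0 x0 by split=> //; rewrite Gx0; exists e0.
have V0E x : V0 x -> [/\ cdom (fct c) (phi x),
    cfun (fct c) (phi x) = G (cfun (fcb c) x) & proj (phi x) = x].
  move=> [cx Gx]; have [cp Ep] := cfun_cinv Gx; split=> //.
  have [cpx] := fc_fibred cp; rewrite Ep row_mxKl => Epx.
  exact: (cfun_inj cpx cx).
have h : lsec x0 phi.
  split.
    by apply: filterS (near_open oV0 V0x0) => x /V0E[].
  move=> d dx0; rewrite /= phix0 in dx0.
  have [dbx0 _] := fc_fibred dx0.
  pose W := cfun (fct c) @` (cdom (fct c) `&` cdom (fct d)).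
  have oW : open W.
    apply: open_cfun_image; last by move=> ? [].
    by apply: openI; exact: cdom_open.
  pose V := cdom (fcb d) `&` N W.
  have oV : open V by apply: openI; [exact: cdom_open|exact: oN].
  exists V; split=> //.
  - by split=> //; split=> //; rewrite Gx0; exists e0.
  - by move=> ? [].
  - by move=> x [_ [_ [e [ce de] Ee]]]; rewrite /= /phi -Ee cfunK.
  have oDV : open (cfun (fcb d) @` V) by apply: open_cfun_image => // ? [].
  have oDB : open (cfun (fcb d) @` (cdom (fcb d) `&` cdom (fcb c))).
    apply: open_cfun_image; last by move=> ? [].
    by apply: openI; exact: cdom_open.
  have [TB _] := atlas_compat (fcb_atlas d) (fcb_atlas c).
  have [TE _] := atlas_compat (fct_atlas c) (fct_atlas d).
  have sB : smooth_on (cfun (fcb d) @` V) (cfun (fcb c) \o cinv (fcb d)).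
    by apply: smooth_on_sub TB => _ [x [dx [cx _]] <-]; exists x.
  (* Seen in d, phi is the transition map of the base, followed by G and by the transition map of
     the total space. *)
  have sGB := smooth_on_comp_row oDV oT (fun _ _ => I) sB sG.
  have := smooth_on_comp_row oDV oW _ sGB TE; apply.
  by move=> _ [x [dx [cx Wx]] <-] /=; rewrite cfunK.
exists (jet_at r h); have cz : cdom (fct c) (jtotal (jet_at r h)) by rewrite jtotal_jet_at phix0.
split=> //=; rewrite jcrd_jet_at ?phix0 //.
apply: tcrd_inj => -[i|[al J]]; first by rewrite jcrd_base x0E mxE.
rewrite jcrd_fibre -iterD_taylor -x0E.
apply: (@eq_iterD _ _ (cfun (fcb c) @` V0)); last by exists x0.
  by apply: open_cfun_image => // ? [].
move=> _ [x V0x <-]; have [cx _] := V0x; have [_ Ep _] := V0E _ V0x.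
by rewrite /fibre_part cfunK // Ep /G row_mxKr mxE.
Qed.

Lemma Jspace_image r c : @cs_crd _ _ _ _ (Jspace B r) c @` cs_dom c = @jdom r c.
Proof.
apply/seteqP; split=> [_ [z cz <-]|a /jet_exists[z [cz <-]]]; last by exists z.
rewrite /jdom /= jbottom_jcrd //; last exact: jrep_lsec.
by exists (jtotal z).
Qed.

Lemma rep_crd (X : cspace B) (V : nmodType) c (f : X -> V) (y : 'rV[R]_(cs_dim X)) :
  (cs_crd c @` cs_dom c) y ->
  exists p : X, [/\ cs_dom c p, cs_crd c p = y & rep c f y = f p].
Proof.
move=> [p cp py]; rewrite /rep; case: pselect => [h|[]]; last by exists p.
by have [? ?] := svalP (cid h); exists (sval (cid h)).
Qed.

Lemma smooth_rep r (L : jet B r -> R) c : smooth_fun (X := Jspace B r) L ->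
  smooth_on (@jdom r c) (rep (X := Jspace B r) c (L : _ -> R^o)).
Proof.
move=> /(_ c)[g]; rewrite Jspace_image => sg Lg.
apply: (eq_smooth_on (open_jdom (c := c)) _ sg) => y; rewrite -Jspace_image => /rep_crd E.
by have [p [cp <- ->]] := E R^o L; rewrite Lg.
Qed.

(** [rep] evaluates L at some jet with the coordinates of z. By [smooth_fun], L factors through the
    coordinates, so its value there is that at z. *)
Lemma rep_J r (L : jet B r -> R) c (z : jet B r) : smooth_fun (X := Jspace B r) L ->
  cdom (fct c) (jtotal z) ->
  rep (X := Jspace B r) c (L : _ -> R^o) (jcrd r c (jrep z) (jbase z)) = L z.
Proof.
move=> /(_ c)[g _ Lg] cz.
have im : (@cs_crd _ _ _ _ (Jspace B r) c @` cs_dom c) (jcrd r c (jrep z) (jbase z)).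
  by exists z.
have [p [cp Ep ->]] := @rep_crd (Jspace B r) R^o c L _ im.
by rewrite Lg // Ep -Lg.
Qed.

End Jets.

(** * Determinants and horizontal forms *)

Section Jacobians.
Context {R : realType}.

(* [diff] is the null map where f is not differentiable, so no differentiability
   is needed. *)
Lemma jacobian_coord0 p q (f : 'rV[R]_p -> 'rV[R]_q) (y v : 'rV[R]_p) j :
  'D_v (fun x => f x 0 j : R^o) y = 0 -> (v *m jacobian f y) 0 j = 0.
Proof.
move=> Df0; have [df|ndf] := pselect (differentiable f y).
  by rewrite -deriveEjacobian // -derive_coord.
rewrite /jacobian mul_rV_lin1.
pose P (df : {linear 'rV[R]_p -> 'rV[R]_q}) := continuous df /\
  forall x, f x = f (lim (nbhs y)) + df (x - lim (nbhs y))
                  +o_(x \near y) (x - lim (nbhs y)).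
have dE : 'd f y = get P by [].
have [exP|nP] := pselect (exists df, P df).
  by case: ndf; apply/diffP; exact: (getPex exP).
by rewrite dE getPN ?mxE // => df Pdf; apply: nP; exists df.
Qed.

Lemma jacobian_id_near p (f : 'rV[R]_p -> 'rV[R]_p) (y : 'rV[R]_p) :
  (\near y, f y = y) -> jacobian f y = 1%:M.
Proof.
move=> fy; have df : differentiable f y.
  apply: (@near_eq_differentiable _ _ _ id) => //.
  by apply: filterS fy => x ->.
apply/row_matrixP => i; rewrite rowE row1 -deriveEjacobian //.
rewrite (near_eq_derive _ fy); exact: derive_id.
Qed.

End Jacobians.

Section TwoForms.
Context {R : realType}.

(** Two rows supported in one column are proportional. In the expansion along row a the only minor
    left has lost column i, hence has a zero row. *)
Lemma det_two_rows p (M : 'M[R]_p) (a b i : 'I_p) : a != b ->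
  (forall j, j != i -> M a j = 0) -> (forall j, j != i -> M b j = 0) -> \det M = 0.
Proof.
case: p M a b i => [|p] M a b i; first by case: a.
move=> ab Ma Mb; rewrite (expand_det_row _ a) big1 // => j _.
have [->|/Ma ->] := eqVneq j i; last by rewrite mul0r.
rewrite /cofactor; have [b' bE] : exists b', b = lift a b'.
  by case: (unliftP a b) => [b' ->|E]; [exists b'|rewrite E eqxx in ab].
rewrite (expand_det_row _ b') big1 ?mulr0 // => l _.
rewrite !mxE -bE Mb ?mul0r //.
by rewrite eq_sym neq_lift.
Qed.

Lemma det_zero_row p (M : 'M[R]_p) i : (forall j, M i j = 0) -> \det M = 0.
Proof. by move=> Mi; rewrite (expand_det_row _ i) big1 // => j _; rewrite Mi mul0r. Qed.

Lemma det_row_replaced p (M : 'M[R]_p) i :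
  (forall a b, a != i -> M a b = (a == b)%:R) -> \det M = M i i.
Proof.
move=> Mab; rewrite (expand_det_col _ i) (bigD1 i) //= big1 ?addr0; last first.
  by move=> a ai; rewrite Mab // (negbTE ai) mul0r.
rewrite /cofactor -signr_odd oddD addbb expr0 mul1r.
have -> : row' i (col' i M) = 1%:M; last by rewrite det1 mulr1.
apply/matrixP => a b; rewrite !mxE Mab; last by rewrite eq_sym neq_lift.
by rewrite (inj_eq lift_inj).
Qed.

Lemma det_corner p (M : 'M[R]_p.+1) : (forall a, M (lift ord0 a) ord0 = 0) ->
  \det M = M ord0 ord0 * \det (\matrix_(a, b) M (lift ord0 a) (lift ord0 b)).
Proof.
move=> M0; rewrite (expand_det_col _ ord0) big_ord_recl big1 ?addr0; last first.
  by move=> a _; rewrite M0 mul0r.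
rewrite /cofactor addn0 expr0 mul1r; congr (_ * \det _).
by apply/matrixP => a b; rewrite !mxE.
Qed.

Lemma fcons0 (T : Type) s (t0 : T) (t : 'I_s -> T) : fcons t0 t ord0 = t0.
Proof. by rewrite /fcons unlift_none. Qed.

Lemma fconsS (T : Type) s (t0 : T) (t : 'I_s -> T) a : fcons t0 t (lift ord0 a) = t a.
Proof. by rewrite /fcons liftK. Qed.

Lemma wedge_zero p N (th : 'I_p -> 'rV[R]_N -> R) (v : 'I_p -> 'rV[R]_N) b :
  (forall a, th a (v b) = 0) -> wedge th v = 0.
Proof.
move=> th0; rewrite /wedge -det_tr; apply: (@det_zero_row _ _ b) => a.
by rewrite !mxE.
Qed.

(** The matrix is block triangular, with identity block th a (e b). *)
Lemma wedge_cons p N (th0 : 'rV[R]_N -> R) (th : 'I_p -> 'rV[R]_N -> R)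
    (xi : 'rV[R]_N) (e : 'I_p -> 'rV[R]_N) :
  (forall a, th a xi = 0) -> (forall a b, th a (e b) = (a == b)%:R) ->
  wedge (fcons th0 th) (fcons xi e) = th0 xi.
Proof.
move=> th_xi th_e; rewrite /wedge det_corner => [|a]; last by rewrite mxE fconsS fcons0.
rewrite mxE !fcons0; have -> : (\matrix_(a, b)
   (\matrix_(a0, b0) fcons th0 th a0 (fcons xi e b0)) (lift ord0 a) (lift ord0 b)) = 1%:M :> 'M[R]_p.
  by apply/matrixP => a b; rewrite !mxE !fconsS.
by rewrite det1 mulr1.
Qed.

Lemma wedge_cons_replaced p N (th0 : 'rV[R]_N -> R) (th : 'I_p -> 'rV[R]_N -> R)
    (xi : 'rV[R]_N) (e : 'I_p -> 'rV[R]_N) i :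
  (forall a, a != i -> th a xi = 0) ->
  (forall a b, a != i -> th a (e b) = (a == b)%:R) ->
  wedge (fcons th0 th) (fcons xi e) = th0 xi * th i (e i) - th i xi * th0 (e i).
Proof.
move=> th_xi th_e; rewrite /wedge; set M := \matrix_(a, b) _.
(* The first column of M has at most two nonzero entries, in row 0 and in the row of th i; the
   determinant is split by linearity in this column. *)
pose N0 (u0 u1 : R) : 'M[R]_p.+1 :=
  \matrix_(a, b) (if b == ord0 then if a == ord0 then u0
     else if a == lift ord0 i then u1 else 0 else M a b).
have lift0 (a : 'I_p) : (lift ord0 a == ord0) = false by rewrite eq_sym; apply/negbTE/neq_lift.
have ME : M = N0 (th0 xi) (th i xi).
  apply/matrixP => a b; rewrite !mxE; case: (unliftP ord0 b) => [b'|] ->.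
    by rewrite lift0.
  rewrite eqxx fcons0; case: (unliftP ord0 a) => [a'|] ->.
    rewrite lift0 fconsS (inj_eq lift_inj); case: eqP => [->//|/eqP ai].
    exact: th_xi.
  by rewrite eqxx fcons0.
have N1 : \det (N0 (th0 xi) 0) = th0 xi * th i (e i).
  rewrite det_corner => [|a]; last by rewrite mxE eqxx lift0; case: ifP.
  rewrite mxE !eqxx; congr (_ * _).
  rewrite (@det_row_replaced _ _ i) ?mxE ?lift0 ?mxE ?fconsS //.
  by move=> a b ai; rewrite !mxE lift0 !fconsS th_e.
(* Exchanging row 0 with the row of th i brings the entry to the corner and produces the sign. *)
have N2 : \det (N0 0 (th i xi)) = - (th i xi * th0 (e i)).
  have -> : N0 0 (th i xi) = perm_mx (tperm ord0 (lift ord0 i)) *m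
      row_perm (tperm ord0 (lift ord0 i)) (N0 0 (th i xi)).
    by rewrite -row_permE -row_permM tperm2 row_perm1.
  rewrite det_mulmx det_perm odd_tperm neq_lift expr1 mulN1r; congr (- _).
  rewrite det_corner => [|a]; last first.
    rewrite !mxE eqxx; case: tpermP => [||/eqP].
    - by move/eqP; rewrite lift0.
    - by rewrite eqxx.
    by rewrite lift0 => _ /eqP/negbTE ->.
  rewrite !mxE tpermL eqxx lift0 eqxx; congr (_ * _).
  rewrite (@det_row_replaced _ _ i); last first.
    move=> a b ai; rewrite !mxE lift0.
    by rewrite tpermD ?fconsS ?th_e // 1?eq_sym ?lift0 // (inj_eq lift_inj).
  by rewrite !mxE tpermR lift0 fcons0 fconsS.
rewrite ME -N1 -N2 -[LHS]det_tr -(det_tr (N0 (th0 xi) 0)) -(det_tr (N0 0 (th i xi))).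
rewrite (@determinant_multilinear _ _ (N0 (th0 xi) (th i xi))^T (N0 (th0 xi) 0)^T
  (N0 0 (th i xi))^T ord0 1 1) ?mul1r //.
- apply/rowP => a; rewrite !mxE eqxx !mul1r.
  by case: eqP => _; rewrite ?addr0 //; case: ifP; rewrite ?add0r ?addr0.
- by apply/matrixP => a b; rewrite !mxE lift0.
- by apply/matrixP => a b; rewrite !mxE lift0.
Qed.

End TwoForms.

(** * Forms vanishing on two vertical vectors *)

Section HorizontalTwoForms.
Context {R : realType} {m n r : nat}.
Let V := 'rV[R]_#|jidx m n r|.
Implicit Types (om : ('I_m -> V) -> R) (v w : 'I_m -> V).

Definition dxbasis (a : 'I_m) : V := tbasis (inl a : jidx m n r).
Definition dubasis (al : 'I_n) (J : mi m r) : V := tbasis (inr (al, J) : jidx m n r).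
Definition slot v (i : 'I_m) (y : V) : 'I_m -> V := fun a => if a == i then y else v a.

Lemma form2_comb om om' (x : R) : form2 om -> form2 om' ->
  form2 (fun v => x * om v + om' v).
Proof.
move=> [l1 a1 h1] [l2 a2 h2]; split=> [v a s y|v a b ab vab|v a b ab va vb].
- by rewrite l1 l2; ring.
- by rewrite (a1 _ a b) // (a2 _ a b) // mulr0 addr0.
- by rewrite (h1 _ a b) // (h2 _ a b) // mulr0 addr0.
Qed.

Lemma form20 : form2 (fun _ : 'I_m -> V => 0 : R).
Proof. by split=> // v a s y; rewrite mulr0 addr0. Qed.

Lemma form2_sum (I : Type) (s : seq I) (F : I -> ('I_m -> V) -> R) (x : I -> R) :
  (forall i, form2 (F i)) -> form2 (fun v => \sum_(i <- s) x i * F i v).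
Proof.
move=> fF; elim: s => [|i s IH].
  have -> : (fun v => \sum_(i <- [::]) x i * F i v) = (fun _ => 0).
    by apply/funext => v; rewrite big_nil.
  exact: form20.
have -> : (fun v => \sum_(j <- i :: s) x j * F j v) =
          (fun v => x i * F i v + \sum_(j <- s) x j * F j v).
  by apply/funext => v; rewrite big_cons.
exact: form2_comb.
Qed.

(** A wedge of coordinate differentials with at most one du among them: vertical vectors give rows
    supported in its column. The premise is guarded by an element of 'I_m because for m = 0 there is
    no index i to name. *)
Lemma form2_det (t : 'I_m -> jidx m n r) :
  ('I_m -> exists i, forall b, b != i -> t b = inl b) ->
  form2 (fun v => \det (\matrix_(a, b) tcrd (v a) (t b))).
Proof.
move=> tP; split=> [v a s y|v a b ab vab|v a b ab va vb].
- rewrite -[X in _ = _ + X]mul1r; apply: (determinant_multilinear (i0 := a)).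
  + by apply/rowP => b; rewrite !mxE eqxx tcrdD tcrdZ mul1r.
  + by apply/matrixP => b c; rewrite !mxE ![lift _ _ == _]eq_sym !(negbTE (neq_lift _ _)).
  + by apply/matrixP => b c; rewrite !mxE ![lift _ _ == _]eq_sym !(negbTE (neq_lift _ _)).
- by apply: (determinant_alternate ab) => c; rewrite !mxE vab.
- have [i ti] := tP a.
  by apply: (@det_two_rows _ _ _ a b i) => // j ji; rewrite mxE ti // (va, vb).
Qed.

(** The witness is p d^m x + P^{J,i}_al du^al_J /\ d^{m-1}x_i, so every choice of momentum
    coordinates occurs in W_0. *)
Lemma form2_exists (p : R) (P : 'I_n -> mi m r -> 'I_m -> R) :
  exists om, [/\ form2 om, om dxbasis = p &
    forall al J i, om (slot dxbasis i (dubasis al J)) = P al J i].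
Proof.
(* For q = (al, J, i): the differentials dx^1, ..., dx^m with du^al_J in the place of dx^i. *)
pose t (q : 'I_n * mi m r * 'I_m) (b : 'I_m) : jidx m n r :=
  if b == q.2 then inr q.1 else inl b.
pose D (t : 'I_m -> jidx m n r) v := \det (\matrix_(a, b) tcrd (v a) (t b)).
pose Dx v := D inl v.
exists (fun v => p * Dx v + \sum_q P q.1.1 q.1.2 q.2 * D (t q) v); split.
- apply: form2_comb; first by apply: form2_det => a; exists a.
  apply: form2_sum => q; apply: form2_det => _; exists q.2 => b /negbTE bq.
  by rewrite /t bq.
- rewrite big1 => [|q _].
    rewrite /Dx /D (_ : \matrix_(a, b) _ = 1%:M) ?det1 ?mulr1 ?addr0 //.
    by apply/matrixP => a b; rewrite !mxE tcrd_basis [in RHS]eq_sym.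
  rewrite /D -det_tr (@det_zero_row _ _ _ q.2) ?mulr0 // => a.
  by rewrite !mxE /t eqxx tcrd_basis.
move=> al J i.
rewrite /Dx {1}/D (@det_zero_row _ _ _ i) => [|b]; last first.
  by rewrite mxE /slot eqxx tcrd_basis.
rewrite mulr0 add0r (bigD1 (al, J, i)) //= big1 ?addr0 => [|[[al' J'] i'] /= qi].
  rewrite /D (@det_row_replaced _ _ _ i) => [|a b ai].
    by rewrite mxE /slot /t /= eqxx tcrd_basis eqxx mulr1.
  rewrite mxE /slot (negbTE ai) /t /=; case: eqP => [->|_]; last first.
    by rewrite tcrd_basis [in RHS]eq_sym.
  by rewrite tcrd_basis (negbTE ai).
rewrite /D; have [ii'|ii'] := eqVneq i' i.
  rewrite (@det_row_replaced _ _ _ i) => [|a b ai].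
    rewrite mxE /slot /t /= ii' eqxx tcrd_basis.
    case: eqP => [[E1 E2]|]; last by rewrite mulr0.
    by rewrite ii' E1 E2 eqxx in qi.
  rewrite mxE /slot (negbTE ai) /t /= ii'; case: eqP => [->|_]; last first.
    by rewrite tcrd_basis [in RHS]eq_sym.
  by rewrite tcrd_basis (negbTE ai).
rewrite (@det_zero_row _ _ _ i') ?mulr0 // => b.
rewrite mxE /slot (negbTE ii') /t /=; case: eqP => [_|/eqP bi]; rewrite tcrd_basis //.
by rewrite (_ : _ == _ = (b == i')) // (negbTE bi).
Qed.

Lemma form2_linear om v i : form2 om ->
  forall (s : R) y y', om (slot v i (s *: y + y')) = s * om (slot v i y) + om (slot v i y').
Proof.
move=> [l _ _] s y y'; have := l (slot v i y') i s y.
have -> : (fun b => if b == i then s *: y + slot v i y' i else slot v i y' b) =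
          slot v i (s *: y + y').
  by apply/funext => b; rewrite /slot eqxx; case: eqP.
have -> // : (fun b => if b == i then y else slot v i y' b) = slot v i y.
by apply/funext => b; rewrite /slot; case: eqP.
Qed.

Lemma form2_slot0 om v i : form2 om -> om (slot v i 0) = 0.
Proof.
move=> f2; have := form2_linear v i f2 (-1) 0 0.
by rewrite scaler0 addr0 mulN1r addNr.
Qed.

Lemma form2_slot_sum om v i (I : Type) (s : seq I) (c : I -> R) (y : I -> V) :
  form2 om ->
  om (slot v i (\sum_(q <- s) c q *: y q)) = \sum_(q <- s) c q * om (slot v i (y q)).
Proof.
move=> f2; elim: s => [|q s IH]; first by rewrite !big_nil form2_slot0.
by rewrite !big_cons form2_linear // IH.
Qed.

(** In the multilinear expansion, the terms with two or more vertical arguments vanish. *)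
Lemma form2_expand om v w : form2 om -> (forall a, jvertical (w a)) ->
  om (fun a => v a + w a) = om v + \sum_i om (slot v i (w i)).
Proof.
move=> f2 vert.
(* The vectors w a are added one index at a time; s lists the indices already treated. *)
pose part (s : seq 'I_m) a := if a \in s then v a + w a else v a.
have slotK u i : slot u i (u i) = u.
  by apply/funext => b; rewrite /slot; case: eqP => [->|].
have two_vertical s i : i \notin s -> uniq s -> om (slot (part s) i (w i)) = om (slot v i (w i)).
  elim: s => // j s IH; rewrite in_cons negb_or => /andP[ij is_] /= /andP[js us].
  rewrite -IH //.
  have -> : slot (part (j :: s)) i (w i) =
      slot (slot (part s) i (w i)) j (1 *: w j + slot (part s) i (w i) j).
    apply/funext => b; rewrite /slot /part in_cons.
    have [->|bj] := eqVneq b j; last by [].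
    by rewrite eq_sym (negbTE ij) (negbTE js) scale1r addrC.
  rewrite form2_linear // slotK; case: f2 => _ _ h2.
  rewrite (h2 _ i j) // ?mulr0 ?add0r //; first by rewrite /slot (negbTE ij) eqxx.
  by rewrite /slot eqxx.
have main s : uniq s -> om (part s) = om v + \sum_(i <- s) om (slot v i (w i)).
  elim: s => [_|i s IH /= /andP[is_ us]].
    by rewrite big_nil addr0.
  rewrite big_cons addrCA -IH // -(two_vertical s) //.
  have -> : part (i :: s) = slot (part s) i (1 *: w i + part s i).
    apply/funext => b; rewrite /slot /part in_cons.
    by have [->|bi] := eqVneq b i; rewrite // (negbTE is_) scale1r addrC.
  by rewrite form2_linear // slotK mul1r.
rewrite -main ?index_enum_uniq //; congr om; apply/funext => a.
by rewrite /part mem_index_enum.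
Qed.

End HorizontalTwoForms.

(** * Coordinates on W_0 *)

Section LocalSections.
Context {R : realType} {m n : nat} {B : fbundle R m n}.
Implicit Types (c d : fchart B) (x : base B) (phi psi : base B -> total B).

Lemma lsec_local x phi c : lsec x phi -> cdom (fct c) (phi x) ->
  exists V : set (base B), [/\ open V, V x, V `<=` cdom (fcb c) &
    forall al, smooth_on (cfun (fcb c) @` V) (fibre_part c phi al)].
Proof.
move=> [_ /(_ c)] sm cx; have [V [oV Vx Vc _ sV]] := sm cx.
exists V; split=> // al.
have oY : open (cfun (fcb c) @` V) by exact: open_cfun_image.
apply: (eq_smooth_on oY _ (smooth_on_coord (rshift m al) oY sV)) => y _.
by rewrite /fibre_part mxE.
Qed.

(** The total derivative d/dx^i at the (r+1)-jet y as a tangent vector to the space of r-jets; it is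
    the i-th velocity of a prolongation. *)
Definition dtot_vec r (i : 'I_m) (y : 'rV[R]_#|jidx m n r.+1|) : 'rV[R]_#|jidx m n r| :=
  tbasis (inl i : jidx m n r) + \sum_(q : 'I_n * mi m r)
    tcrd y (inr (q.1, mi_succ q.2 i)) *: tbasis (inr q : jidx m n r).

Lemma tcrd_sum (T : finType) (I : Type) (s : seq I) (F : I -> 'rV[R]_#|T|) t :
  tcrd (\sum_(q <- s) F q) t = \sum_(q <- s) tcrd (F q) t.
Proof. by elim: s => [|q s IH]; rewrite !(big_nil, big_cons) ?tcrdD ?IH // /tcrd mxE. Qed.

Lemma dtot_vec_base r i (y : 'rV[R]_#|jidx m n r.+1|) j : tcrd (dtot_vec i y) (inl j) = (j == i)%:R.
Proof.
rewrite tcrdD tcrd_sum big1 ?addr0 => [|q _]; first by rewrite tcrd_basis.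
by rewrite tcrdZ tcrd_basis mulr0.
Qed.

Lemma dtot_vec_fibre r i (y : 'rV[R]_#|jidx m n r.+1|) al J :
  tcrd (dtot_vec i y) (inr (al, J)) = tcrd y (inr (al, mi_succ J i)).
Proof.
rewrite tcrdD tcrd_sum tcrd_basis add0r (bigD1 (al, J)) //= big1 ?addr0 => [|q qJ].
  by rewrite tcrdZ tcrd_basis eqxx mulr1.
rewrite tcrdZ tcrd_basis; case: eqP => [[E]|_]; last by rewrite mulr0.
by rewrite E eqxx in qJ.
Qed.

Lemma smooth_jcrd r (V : set (base B)) c phi : open V -> V `<=` cdom (fcb c) ->
  (forall al, smooth_on (cfun (fcb c) @` V) (fibre_part c phi al)) ->
  smooth_on (cfun (fcb c) @` V) (fun y => jcrd r c phi (cinv (fcb c) y)).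
Proof.
move=> oV Vc sV; have oY : open (cfun (fcb c) @` V) by exact: open_cfun_image.
apply: smooth_on_row => // j; rewrite -(enum_valK j).
have cfunKV y : (cfun (fcb c) @` V) y -> cfun (fcb c) (cinv (fcb c) y) = y.
  by move=> [x Vx <-]; rewrite cfunK //; exact: Vc.
case: (enum_val j) => [i|[al J]].
  apply: (eq_smooth_on oY _ (@smooth_row_coord R m (cfun (fcb c) @` V) i)) => y Yy.
  by rewrite -[RHS]/(tcrd _ _) jcrd_base cfunKV.
apply: (eq_smooth_on oY _ (smooth_on_iterD (mi_seq J) (sV al))) => y Yy.
by rewrite -[RHS]/(tcrd _ _) jcrd_fibre cfunKV.
Qed.

Lemma derive_tcrd (V : normedModType R) (T : finType) (f : V -> 'rV[R]_#|T|) (x v : V) t :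
  differentiable f x -> tcrd ('D_v f x) t = 'D_v (fun y => tcrd (f y) t : R^o) x.
Proof. by move=> df; rewrite derive_coord. Qed.

Lemma derive_jcrd_local r (V : set (base B)) c phi x i : open V -> V `<=` cdom (fcb c) ->
  (forall al, smooth_on (cfun (fcb c) @` V) (fibre_part c phi al)) -> V x ->
  'D_(delta_mx 0 i) (fun y => jcrd r c phi (cinv (fcb c) y)) (cfun (fcb c) x) =
  dtot_vec i (jcrd r.+1 c phi x).
Proof.
move=> oV Vc sV Vx; have oY : open (cfun (fcb c) @` V) by exact: open_cfun_image.
have Yx : (cfun (fcb c) @` V) (cfun (fcb c) x) by exists x.
have df := smooth_on_differentiable (@smooth_jcrd r V c phi oV Vc sV) Yx.
have cfunKV y : (cfun (fcb c) @` V) y -> cfun (fcb c) (cinv (fcb c) y) = y.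
  by move=> [x' Vx' <-]; rewrite cfunK //; exact: Vc.
apply: tcrd_inj => -[j|[al J]]; rewrite derive_tcrd //.
  rewrite dtot_vec_base.
  rewrite (eq_derive_on (g := fun y : 'rV[R]_m => y 0 j : R^o) _ oY Yx); last first.
    by move=> y Yy; rewrite jcrd_base cfunKV.
  by rewrite (derive_coord (f := id)) // derive_id mxE eqxx.
rewrite dtot_vec_fibre jcrd_fibre.
rewrite (perm_iterD oY (sV al) (perm_mi_succ J i) Yx).
apply: (eq_derive_on _ oY Yx) => y Yy.
by rewrite jcrd_fibre cfunKV.
Qed.

Lemma derive_jcrd r c phi x i : lsec x phi -> cdom (fct c) (phi x) ->
  'D_(delta_mx 0 i) (fun y => jcrd r c phi (cinv (fcb c) y)) (cfun (fcb c) x) =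
  dtot_vec i (jcrd r.+1 c phi x).
Proof.
move=> h cx; have [V [oV Vx Vc sV]] := lsec_local h cx.
exact: (derive_jcrd_local r i oV Vc sV Vx).
Qed.

End LocalSections.

(** * Changes of chart and the coordinate image of W_0 *)

Section SymmetrizedSpace.
Context {R : realType} {m n : nat} {B : fbundle R m n} {k : nat}.
Implicit Types (c d : fchart B) (w : W0 B k).

Lemma jet_base_of_chart r (z : jet B r) c (y : 'rV[R]_#|jidx m n r|) :
  cdom (fct c) (jtotal z) -> jcrd r c (jrep z) (jbase z) = y ->
  jbase z = cinv (fcb c) (\row_i tcrd y (inl i)).
Proof.
move=> cz <-; rewrite -[LHS](cfunK (jet_chart cz)); congr (cinv _ _).
by apply/rowP => i; rewrite mxE jcrd_base.
Qed.

(** Along a vertical line the base point is fixed, and with it the base coordinates in d. *)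
Lemma jac_vertical r (z : jet B r) c d (v : 'rV[R]_#|jidx m n r|) :
  cdom (fct c) (jtotal z) -> jvertical v ->
  jvertical (v *m jac (X := Jspace B r) c d z).
Proof.
move=> cz vv i; rewrite /tcrd; apply: jacobian_coord0.
pose y0 : 'rV[R]_#|jidx m n r| := jcrd r c (jrep z) (jbase z).
have y0D : @jdom _ _ _ B r c y0 by rewrite -Jspace_image; exists z.
rewrite (eq_derive_line (g := fun=> cfun (fcb d) (cinv (fcb c) (\row_i tcrd y0 (inl i))) 0 i : R^o)).
  exact: derive_cst.
have := open_line v (@open_jdom _ _ _ B r c) y0D; apply: filterS => t Dt.
have im : (@cs_crd _ _ _ B (Jspace B r) c @` cs_dom c) (t *: v + y0) by rewrite Jspace_image.
have [p [cp Ep ->]] := rep_crd (@cs_crd _ _ _ B (Jspace B r) d) im.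
rewrite -[LHS]/(tcrd _ _) /= jcrd_base (jet_base_of_chart cp Ep).
congr (cfun _ (cinv _ _) _ _); apply/rowP => j.
by rewrite !mxE tcrdD tcrdZ vv mulr0 add0r.
Qed.

Lemma jac_refl r (z : jet B r) c : cdom (fct c) (jtotal z) ->
  jac (X := Jspace B r) c c z = 1%:M.
Proof.
move=> cz; apply: jacobian_id_near.
have : @jdom _ _ _ B r c (jcrd r c (jrep z) (jbase z)) by rewrite -Jspace_image; exists z.
move=> /(near_open (@open_jdom _ _ _ B r c)); apply: filterS => y.
rewrite /= -Jspace_image => im.
by have [p [cp Ep ->]] := rep_crd (@cs_crd _ _ _ B (Jspace B r) c) im.
Qed.

Lemma jproj_total r l (z : jet B r) : jtotal (jproj l z) = jtotal z.
Proof. exact: jtotal_jet_at. Qed.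

Lemma form2_pullback r (om : ('I_m -> 'rV[R]_#|jidx m n r|) -> R)
    (J : 'M[R]_#|jidx m n r|) : form2 om ->
  (forall v, jvertical v -> jvertical (v *m J)) ->
  form2 (fun v => om (fun a => v a *m J)).
Proof.
move=> [l a h] vert; split=> [v b s y|v b b' bb' vb|v b b' bb' vb vb'].
- have -> : (fun a => (if a == b then s *: y + v b else v a) *m J) =
      (fun a => if a == b then s *: (y *m J) + v b *m J else v a *m J).
    by apply/funext => b'; case: eqP => // _; rewrite mulmxDl -scalemxAl.
  have -> : (fun a => (if a == b then y else v a) *m J) =
      (fun a => if a == b then y *m J else v a *m J).
    by apply/funext => b'; case: eqP.
  exact: (l (fun a => v a *m J)).
- by apply: (a _ b b') => //; rewrite vb.
- by apply: (h _ b b') => //; exact: vert.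
Qed.

(** [Lambda2] asserts [form2] in one chart only; Jacobians preserve verticality and so carry it to
    the others. *)
Lemma wform_form2 w c : cdom (fct c) (wtotal w) -> form2 (sval (wform w) c).
Proof.
move=> cw; have cz : cdom (fct c) (jtotal (jproj k.-1 (wjet w))) by rewrite jproj_total.
have [[d [dz f2 E]] _] := svalP (wform w).
have -> := funext (E c cz); apply: form2_pullback f2 _ => v.
exact: jac_vertical.
Qed.

Lemma wspace_exists c (z : jet B k) om : cdom (fct c) (jtotal z) -> form2 om ->
  exists w : W0 B k, wjet w = z /\ sval (wform w) c = om.
Proof.
move=> cz f2; pose z' := jproj k.-1 z.
have cz' : cs_dom c (z' : Jspace B k.-1) by rewrite /= jproj_total.
(* The components are transported from c by the Jacobians, with the value 0 that [Lambda2] demands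
   in charts not around z. *)
pose OM d v := if pselect (cs_dom d (z' : Jspace B k.-1)) is left _
  then om (fun a => v a *m jac d c (z' : Jspace B k.-1)) else 0.
have OMc : OM c = om.
  apply/funext => v; rewrite /OM; case: pselect => // _; congr om.
  by apply/funext => a; rewrite jac_refl ?mulmx1.
have OMP : (exists c0, [/\ cs_dom c0 (z' : Jspace B k.-1), form2 (OM c0) &
       forall d, cs_dom d (z' : Jspace B k.-1) -> forall v,
         OM d v = OM c0 (fun a => v a *m jac d c0 (z' : Jspace B k.-1))]) /\
    (forall d, ~ cs_dom d (z' : Jspace B k.-1) -> forall v, OM d v = 0).
  split; last by move=> d nd v; rewrite /OM; case: pselect.
  exists c; split=> // [|d dz v]; first by rewrite OMc.
  by rewrite OMc /OM; case: pselect.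
by exists (@MkW0 _ _ _ _ k z (exist _ OM OMP)).
Qed.

Definition jpart (y : 'rV[R]_#|widx m n k|) : 'rV[R]_#|jidx m n k| :=
  tvec (fun t : jidx m n k => tcrd y (inl (inl t))).

Lemma jpart_wcrd c w : jpart (wcrd c w) = jcrd k c (jrep (wjet w)) (wbase w).
Proof. by apply: tcrd_inj => t; rewrite !tcrd_tvec. Qed.

Lemma wcrd_jet c w t : tcrd (wcrd c w) (inl (inl t)) =
  tcrd (jcrd k c (jrep (wjet w)) (wbase w)) t.
Proof. exact: tcrd_tvec. Qed.

Lemma jpart_affine (t : R) (v y : 'rV[R]_#|widx m n k|) :
  jpart (t *: v + y) = t *: jpart v + jpart y.
Proof. by apply: tcrd_inj => q; rewrite !(tcrdD, tcrdZ, tcrd_tvec). Qed.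

(** The momenta are unconstrained by [form2_exists], so only the jet part of the coordinates
    matters. *)
Lemma wspace_image c : @cs_crd _ _ _ _ (Wspace k) c @` cs_dom c =
  [set y | @jdom _ _ _ B k c (jpart y)].
Proof.
apply/seteqP; split=> [_ [w cw <-]|y /= Dy].
  by rewrite /= jpart_wcrd -Jspace_image; exists (wjet w).
have [z [cz Ez]] := jet_exists Dy.
have [om [f2 omp omP]] := form2_exists (tcrd y wp)
  (fun al (J : mi m k.-1) i => tcrd y (wpI al J i)).
have [w [wz wom]] := wspace_exists cz f2.
exists w; first by rewrite /= /wtotal wz.
apply: tcrd_inj => -[[t|[[al J] i]]|[]].
- rewrite tcrd_tvec; transitivity (tcrd (jpart y) t); last by rewrite tcrd_tvec.
  by rewrite -Ez /wbase wz.
- by rewrite tcrd_tvec wom -omP.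
- by rewrite tcrd_tvec wom -omp.
Qed.

Lemma smooth_jpart : smooth_on setT jpart.
Proof.
have oT : open [set: 'rV[R]_#|widx m n k|] by exact: openT.
apply: smooth_on_row => // j.
apply: (eq_smooth_on oT _ (@smooth_tcrd R _ setT (inl (inl (enum_val j)) : widx m n k))) => y _.
by rewrite /jpart mxE.
Qed.

Lemma open_wdom c : open [set y | @jdom _ _ _ B k c (jpart y)].
Proof.
apply: openP => y Dy; apply: (smooth_on_continuous smooth_jpart) => //.
exact: (near_open (@open_jdom _ _ _ B k c) Dy).
Qed.

End SymmetrizedSpace.

(** * The Hamilton equations *)

Section Hamiltonian.
Context {R : realType} {m n k : nat} {B : fbundle R m n}.
Context (eta : volume_form (base B)) (Phi : W0 B k.+1 -> R) (L : jet B k.+1 -> R).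
Hypotheses (Phi_pairing : is_pairing eta Phi)
  (L_smooth : smooth_fun (X := Jspace B k.+1) L).
Implicit Types (c : fchart B) (w : W0 B k.+1).
Let Y := 'rV[R]_#|widx m n k.+1|.

(** The coordinate expression of vol Phi. The order of the jets is [k.+1] from here on, so that the
    index type [mi m k.-1] of the momenta computes to [mi m k]. *)
Definition pairing_crd (y : Y) : R :=
  tcrd y wp + \sum_(i < m) \sum_(q : 'I_n * mi m k)
    tcrd y (wu q.1 (mi_succ q.2 i)) * tcrd y (wpI (k := k.+1) q.1 q.2 i).

(** Each velocity of j^{k-1} phi is d/dx^i plus a vertical vector, so [form2_expand] evaluates the
    form on them. *)
Lemma pairing_crdE w c : cdom (fct c) (wtotal w) ->
  Phi w * vol eta (fcb c) (wbase w) = pairing_crd (wcrd c w).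
Proof.
move=> cw; have h := jrep_lsec (wjet w).
rewrite (Phi_pairing (jrep_class (wjet w)) cw).
have -> : (fun i => 'D_(delta_mx 0 i) (fun y => jcrd k c (jrep (wjet w)) (cinv (fcb c) y))
     (cfun (fcb c) (wbase w))) =
   fun i : 'I_m => dxbasis i + \sum_(q : 'I_n * mi m k)
     tcrd (wcrd c w) (wu q.1 (mi_succ q.2 i)) *: dubasis q.1 q.2.
  apply/funext => i; rewrite derive_jcrd //; congr (_ + _); apply: eq_bigr => -[al J] _.
  by rewrite [in RHS]tcrd_tvec.
have f2 : form2 (sval (wform w) c) := wform_form2 cw.
rewrite (form2_expand _ f2); last first.
  move=> i j; rewrite tcrd_sum big1 // => q _.
  by rewrite tcrdZ tcrd_basis mulr0.
rewrite /pairing_crd; congr (_ + _); first by rewrite tcrd_tvec.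
apply: eq_bigr => i _; rewrite (form2_slot_sum _ _ _ _ _ f2).
by apply: eq_bigr => -[al J] _; rewrite [in RHS](tcrd_tvec _ (wpI (k := k.+1) al J i)).
Qed.

Lemma differentiable_pairing_crd (y : Y) : differentiable (pairing_crd : _ -> R^o) y.
Proof.
have oT : open [set: Y] by exact: openT.
apply: (@smooth_on_differentiable _ _ _ setT) => //.
apply: smooth_onD => //; first exact: smooth_tcrd.
apply: smooth_on_sum => // i; apply: smooth_on_sum => // q.
by apply: smooth_onM => //; exact: smooth_tcrd.
Qed.

Lemma derive_pairing_crd (y xi : Y) :
  'D_xi (pairing_crd : _ -> R^o) y = tcrd xi wp +
    \sum_(i < m) \sum_(q : 'I_n * mi m k)
      (tcrd y (wu q.1 (mi_succ q.2 i)) * tcrd xi (wpI (k := k.+1) q.1 q.2 i) +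
       tcrd y (wpI (k := k.+1) q.1 q.2 i) * tcrd xi (wu q.1 (mi_succ q.2 i))).
Proof.
have dt (t : widx m n k.+1) : is_derive y xi (fun y : Y => tcrd y t : R^o) (tcrd xi t).
  have df : differentiable (fun y : Y => tcrd y t : R^o) y.
    by apply: (smooth_on_differentiable (@smooth_tcrd R _ setT t)).
  apply: DeriveDef; first exact: diff_derivable.
  by rewrite (derive_coord (f := id)) // derive_id.
have -> : (pairing_crd : _ -> R^o) = (fun y : Y => tcrd y wp : R^o) +
    (fun y : Y => \sum_(i < m) \sum_(q : 'I_n * mi m k)
      tcrd y (wu q.1 (mi_succ q.2 i)) * tcrd y (wpI (k := k.+1) q.1 q.2 i) : R^o).
  by [].
apply: derive_val; apply: is_deriveD; apply: is_derive_bigsum => i.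
apply: is_derive_bigsum => q; exact: is_deriveM.
Qed.

Lemma derive_H0 w c (xi : Y) : cdom (fct c) (wtotal w) -> wvertical xi ->
  vol eta (fcb c) (wbase w) *
    'D_xi (rep (X := Wspace k.+1) c (H0 Phi L : _ -> R^o)) (wcrd c w) =
  'D_xi (pairing_crd : _ -> R^o) (wcrd c w) -
  vol eta (fcb c) (wbase w) *
    'D_(jpart xi) (rep (X := Jspace B k.+1) c (L : _ -> R^o)) (jpart (wcrd c w)).
Proof.
move=> cw vxi; set y0 := wcrd c w; set v0 := vol eta (fcb c) (wbase w).
have v0N0 : v0 != 0 by apply: vol_neq0; [exact: fcb_atlas|exact: jet_chart cw].
pose LJ : 'rV[R]_#|jidx m n k.+1| -> R^o := rep (X := Jspace B k.+1) c (L : _ -> R^o).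
have y0D : @jdom _ _ _ B k.+1 c (jpart y0).
  by rewrite /y0 jpart_wcrd -Jspace_image; exists (wjet w).
(* On the line through y0 in the vertical direction xi the base point, hence vol, is that of w, so
   H_0 agrees there with F; F itself is differentiable. *)
pose F : Y -> R^o := v0^-1 *: (pairing_crd : Y -> R^o) - (LJ \o @jpart R m n k.+1).
have -> : 'D_xi (rep (X := Wspace k.+1) c (H0 Phi L : _ -> R^o)) y0 = 'D_xi F y0.
  apply: eq_derive_line.
  have := open_line xi (@open_wdom R m n B k.+1 c) y0D; apply: filterS => t Dt.
  have im : (@cs_crd _ _ _ B (Wspace k.+1) c @` cs_dom c) (t *: xi + y0).
    by rewrite wspace_image.
  have [w' [cw' Ew' ->]] := @rep_crd _ _ _ B (Wspace k.+1) R^o c (H0 Phi L) _ im.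
  have base : wbase w' = wbase w.
    rewrite /wbase (@jet_base_of_chart _ _ _ _ _ _ c (jpart (t *: xi + y0))) //; last first.
      by rewrite -Ew' /= jpart_wcrd.
    rewrite [RHS](@jet_base_of_chart _ _ _ _ _ _ c (jpart y0)) //; last first.
      by rewrite /y0 jpart_wcrd.
    congr (cinv _ _); apply/rowP => i; rewrite !mxE jpart_affine tcrdD tcrdZ.
    have -> : tcrd (jpart xi) (inl i) = 0 by rewrite tcrd_tvec; exact: vxi.
    by rewrite mulr0 add0r.
  rewrite /H0 -[RHS]/(v0^-1 * pairing_crd (t *: xi + y0) - LJ (jpart (t *: xi + y0))).
  rewrite -Ew' -pairing_crdE // base -/v0 mulrCA mulVf // mulr1; congr (_ - _).
  by rewrite /LJ /= jpart_wcrd rep_J.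
have dP : derivable (pairing_crd : Y -> R^o) y0 xi.
  exact: diff_derivable (differentiable_pairing_crd y0).
have dLJ : differentiable LJ (jpart y0).
  apply: (@smooth_on_differentiable _ _ _ (@jdom R m n B k.+1 c) LJ (jpart y0) _ y0D).
  exact: smooth_rep.
have dj : differentiable (@jpart R m n k.+1) y0.
  exact: (smooth_on_differentiable (U := setT) (@smooth_jpart R m n k.+1)).
have dL : derivable (LJ \o @jpart R m n k.+1) y0 xi.
  by apply: diff_derivable; exact: differentiable_comp.
rewrite /F (deriveB (derivableZ dP) dL) (deriveZ _ dP).
rewrite (@derive_comp_affine _ _ _ _ LJ (@jpart R m n k.+1) y0 xi (jpart xi)); last first.
  by move=> t; rewrite jpart_affine.
by rewrite mulrBr; congr (_ - _); rewrite -[_ *: _]/(_ * _) mulrA divff // mul1r.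
Qed.

End Hamiltonian.

(** * The dynamical equation on one vertical and m horizontal vectors *)

Section HamiltonEquations.
Context {R : realType} {m n k : nat} {B : fbundle R m n}.
Context (eta : volume_form (base B)) (Phi : W0 B k.+1 -> R) (L : jet B k.+1 -> R).
Hypotheses (Phi_pairing : is_pairing eta Phi)
  (L_smooth : smooth_fun (X := Jspace B k.+1) L).
Implicit Types (c : fchart B) (w : W0 B k.+1).
Let Y := 'rV[R]_#|widx m n k.+1|.

(* Both sides of the dynamical equation, evaluated on one vertical vector and m
   horizontal ones, are multiples of the same number, by m and by m - 1. *)
Lemma OmegaH_horizontal w c H (xi : Y) (e : 'I_m -> Y) :
  dynamical_eq eta Phi L w H -> cdom (fct c) (wtotal w) ->
  xi *m H c = 0 -> (forall b, e b *m H c = e b) ->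
  OmegaH eta Phi L w c (fcons xi e) = 0.
Proof.
move=> dyn cw xiH eH; have := dyn c cw (fcons xi e).
rewrite big_ord_recl.
have -> : OmegaH eta Phi L w c (fun b => if b == ord0 then fcons xi e b *m H c else fcons xi e b) = 0.
  rewrite /OmegaH /Omega (wedge_zero (b := ord0)) ?oppr0 ?sub0r; last first.
    move=> a; rewrite eqxx fcons0 xiH /fcons; case: unlift => [a'|];
    by rewrite /dx /dcrd /tcrd mxE.
  rewrite big1 ?oppr0 ?add0r => [|al _]; last first.
    rewrite big1 // => I _; rewrite big1 // => i _; apply: (wedge_zero (b := ord0)) => a.
    rewrite eqxx fcons0 xiH /fcons; case: unlift => [a'|].
      by case: ifP => _; rewrite /dx /dcrd /tcrd mxE.
    by rewrite /dcrd /tcrd mxE.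
  rewrite (wedge_zero (b := ord0)) ?mulr0 // => a.
  rewrite eqxx fcons0 xiH /fcons; case: unlift => [a'|].
    by rewrite /dx /dcrd /tcrd mxE.
  exact: derive0.
rewrite add0r (eq_bigr (fun=> OmegaH eta Phi L w c (fcons xi e))) => [|a _]; last first.
  congr OmegaH; apply/funext => b; case: eqP => // ->.
  by rewrite fconsS eH.
rewrite sumr_const card_ord mulrBl mul1r mulr_natl => /eqP.
by rewrite -subr_eq0 opprB addrC subrK => /eqP.
Qed.

(** The p-component of xi is absent because the term -dp /\ d^m x of Omega cancels the dp coming
    from vol dPhi. *)
Lemma hamilton_equation w c H (xi : Y) (e : 'I_m -> Y) :
  dynamical_eq eta Phi L w H -> cdom (fct c) (wtotal w) ->
  xi *m H c = 0 -> wvertical xi -> (forall b, e b *m H c = e b) ->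
  (forall a b, tcrd (e b) (wx a) = (a == b)%:R) ->
  \sum_(i < m) \sum_(q : 'I_n * mi m k)
    (tcrd xi (wpI (k := k.+1) q.1 q.2 i) *
       (tcrd (wcrd c w) (wu q.1 (mi_succ q.2 i)) -
        tcrd (e i) (wu q.1 (mi_in k.+1 (mi_fun q.2)))) +
     (tcrd xi (wu q.1 (mi_in k.+1 (mi_fun q.2))) * tcrd (e i) (wpI (k := k.+1) q.1 q.2 i) +
      tcrd xi (wu q.1 (mi_succ q.2 i)) * tcrd (wcrd c w) (wpI (k := k.+1) q.1 q.2 i))) =
  vol eta (fcb c) (wbase w) *
    'D_(jpart xi) (rep (X := Jspace B k.+1) c (L : _ -> R^o)) (jpart (wcrd c w)).
Proof.
move=> dyn cw xiH vxi eH dxe; have := OmegaH_horizontal dyn cw xiH eH.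
have dxxi a : dx a xi = 0 by exact: vxi.
rewrite /OmegaH /Omega wedge_cons // wedge_cons // derive_H0 // derive_pairing_crd.
have W al (I : mi m k) i : wedge (fcons (dcrd (wpI (k := k.+1) al I i))
      (fun a => if a == i then dcrd (wu al (mi_in k.+1 (mi_fun I))) else dx a)) (fcons xi e) =
    tcrd xi (wpI (k := k.+1) al I i) * tcrd (e i) (wu al (mi_in k.+1 (mi_fun I))) -
    tcrd xi (wu al (mi_in k.+1 (mi_fun I))) * tcrd (e i) (wpI (k := k.+1) al I i).
  rewrite (@wedge_cons_replaced _ _ _ _ _ _ _ i) ?eqxx // => [a|a b] /negbTE ai; rewrite ai //.
  exact: dxe.
rewrite (eq_bigr (fun al => \sum_(i < m) \sum_(I : mi m k)
   (tcrd xi (wpI (k := k.+1) al I i) * tcrd (e i) (wu al (mi_in k.+1 (mi_fun I))) -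
    tcrd xi (wu al (mi_in k.+1 (mi_fun I))) * tcrd (e i) (wpI (k := k.+1) al I i)))); last first.
  move=> al _; rewrite exchange_big /=; apply: eq_bigr => i _; apply: eq_bigr => I _.
  exact: W.
rewrite exchange_big /=.
rewrite (eq_bigr (fun i => \sum_(q : 'I_n * mi m k)
   (tcrd xi (wpI (k := k.+1) q.1 q.2 i) * tcrd (e i) (wu q.1 (mi_in k.+1 (mi_fun q.2))) -
    tcrd xi (wu q.1 (mi_in k.+1 (mi_fun q.2))) * tcrd (e i) (wpI (k := k.+1) q.1 q.2 i)))); last first.
  by move=> i _; rewrite pair_bigA.
set VL := vol _ _ _ * _; set Q := \sum_i _; set P := \sum_i _; set G := (X in X = VL).
(* P comes from the derivative of vol Phi and Q from the wedges of Omega; the two are combined term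
   by term. *)
have -> : G = P - Q.
  rewrite /G /P /Q -sumrB; apply: eq_bigr => i _; rewrite -sumrB; apply: eq_bigr => q _.
  ring.
rewrite /dcrd => E; apply/eqP; rewrite -subr_eq0; apply/eqP; rewrite -[RHS]E; ring.
Qed.

End HamiltonEquations.

(** * Holonomy of integral sections *)

Section HolonomicSections.
Context {R : realType} {m n k : nat} {B : fbundle R m n}.
Context (eta : volume_form (base B)) (Phi : W0 B k.+1 -> R) (L : jet B k.+1 -> R).
Hypotheses (Phi_pairing : is_pairing eta Phi)
  (L_smooth : smooth_fun (X := Jspace B k.+1) L).
Context (S : set (W0 B k.+1)) (h : W0 B k.+1 -> fchart B -> 'M[R]_#|widx m n k.+1|).
Hypotheses (h_connection : connection_along S h)
  (h_solution : forall w, S w -> dynamical_eq eta Phi L w (h w)).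
Context (U : set (base B)) (sigma : base B -> W0 B k.+1).
Hypotheses (sigma_section : section_on S U sigma)
  (sigma_integral : integral_section h U sigma).

Let phi (x : base B) : total B := wtotal (sigma x).
Let crd (c : fchart B) (y : 'rV[R]_m) : 'rV[R]_#|widx m n k.+1| :=
  wcrd c (sigma (cinv (fcb c) y)).

Definition chart_domain (c : fchart B) (V : set (base B)) : Prop :=
  [/\ open V, V `<=` U, V `<=` cdom (fcb c),
      (forall y, V y -> cdom (fct c) (phi y)) &
      smooth_on (cfun (fcb c) @` V) (crd c)].

Lemma chart_domain_exists c x : U x -> cdom (fct c) (phi x) ->
  exists2 V, chart_domain c V & V x.
Proof.
move=> Ux cx; have [oU HU] := sigma_section; have [_ _ sm] := HU x Ux.
have [V [oV Vx Vc Vd sV]] := sm c cx.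
exists (V `&` U); last by [].
split; first exact: openI.
- by move=> ? [].
- by move=> y [/Vc].
- by move=> y [/Vd].
by apply: smooth_on_sub sV => _ [y [Vy _] <-]; exists y.
Qed.

Section InChart.
Context (c : fchart B) (V : set (base B)).
Hypothesis cV : chart_domain c V.
Let Y := cfun (fcb c) @` V.

Let oY : open Y.
Proof. by case: cV => oV _ Vc _ _; exact: open_cfun_image. Qed.

Let YK y : Y y -> cfun (fcb c) (cinv (fcb c) y) = y.
Proof. by case: cV => _ _ Vc _ _ [x Vx <-]; rewrite cfunK //; exact: Vc. Qed.

Let YV y : Y y -> V (cinv (fcb c) y).
Proof. by case: cV => _ _ Vc _ _ [x Vx <-]; rewrite cfunK //; exact: Vc. Qed.

Lemma smooth_crd t : smooth_on Y (fun y => tcrd (crd c y) t : R^o).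
Proof. by case: cV => _ _ _ _ sV; exact: smooth_on_coord. Qed.

Lemma crd_base y i : Y y -> tcrd (crd c y) (wx i) = y 0 i.
Proof.
move=> Yy; have [_ VU _ _ _] := cV; have [_ HU] := sigma_section.
have [_ base _] := HU _ (VU _ (YV Yy)).
rewrite /crd /wx wcrd_jet jcrd_base base.
exact: (congr1 (fun z : 'rV[R]_m => z 0 i) (YK Yy)).
Qed.

Lemma sigma_equation y (xi : 'rV[R]_#|widx m n k.+1|) : Y y -> wvertical xi ->
  \sum_(i < m) \sum_(q : 'I_n * mi m k)
    (tcrd xi (wpI (k := k.+1) q.1 q.2 i) *
       (tcrd (crd c y) (wu q.1 (mi_succ q.2 i)) -
        'D_(delta_mx 0 i) (fun y => tcrd (crd c y) (wu q.1 (mi_in k.+1 (mi_fun q.2))) : R^o) y) +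
     (tcrd xi (wu q.1 (mi_in k.+1 (mi_fun q.2))) *
        'D_(delta_mx 0 i) (fun y => tcrd (crd c y) (wpI (k := k.+1) q.1 q.2 i) : R^o) y +
      tcrd xi (wu q.1 (mi_succ q.2 i)) * tcrd (crd c y) (wpI (k := k.+1) q.1 q.2 i))) =
  vol eta (fcb c) (cinv (fcb c) y) *
    'D_(jpart xi) (rep (X := Jspace B k.+1) c (L : _ -> R^o)) (jpart (crd c y)).
Proof.
move=> Yy vxi; have [oV VU Vc Vd sV] := cV; have [_ HU] := sigma_section.
set x := cinv (fcb c) y; have Vx : V x by exact: YV.
have [Sx base _] := HU _ (VU _ Vx).
have df : differentiable (crd c) y by exact: smooth_on_differentiable Yy.
have cw : cdom (fct c) (wtotal (sigma x)) by exact: Vd.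
have [[_ /(_ c cw)[hh hker]] _] := h_connection Sx.
(* Integrality puts the velocity in the image of h, on which the idempotent h is the identity. *)
have eh b : 'D_(delta_mx 0 b) (crd c) y *m h (sigma x) c = 'D_(delta_mx 0 b) (crd c) y.
  have E := sigma_integral (VU _ Vx) cw; rewrite YK // in E.
  have : (range (fun v => v *m h (sigma x) c)) ('D_(delta_mx 0 b) (crd c) y).
    by rewrite -E; exists (delta_mx 0 b).
  by case=> v _ <-; rewrite -mulmxA hh.
(* As sigma is a section, its x-coordinates are those of the point y itself. *)
have dxe a b : tcrd ('D_(delta_mx 0 b) (crd c) y) (wx a) = (a == b)%:R.
  rewrite derive_tcrd //.
  rewrite (eq_derive_on (g := fun y : 'rV[R]_m => y 0 a : R^o) _ oY Yy); last first.
    by move=> z; exact: crd_base.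
  by rewrite (derive_coord (f := id)) // derive_id mxE eqxx.
have := hamilton_equation Phi_pairing L_smooth (h_solution Sx) cw
  ((hker xi).2 vxi) vxi eh dxe.
rewrite base => <-; apply: eq_bigr => i _; apply: eq_bigr => q _.
by rewrite -!derive_tcrd.
Qed.

Lemma derive_crd_fibre y al (I : mi m k) i : Y y ->
  'D_(delta_mx 0 i) (fun y => tcrd (crd c y) (wu al (mi_in k.+1 (mi_fun I))) : R^o) y =
  tcrd (crd c y) (wu al (mi_succ I i)).
Proof.
move=> Yy; have := sigma_equation (xi := tbasis (wpI (k := k.+1) al I i)) Yy.
rewrite (bigD1 i) //= (bigD1 (al, I)) //= [X in _ + X]big1 => [|j ji]; last first.
  rewrite big1 // => q _; rewrite !tcrd_basis !mul0r !addr0.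
  case: eqP => [[_ _ E]|]; last by rewrite mul0r.
  by rewrite E eqxx in ji.
rewrite addr0 [X in _ + X]big1 => [|[al' I'] qI]; last first.
  rewrite !tcrd_basis !mul0r !addr0 /=; case: eqP => [[E1 E2]|]; last by rewrite mul0r.
  by rewrite E1 E2 eqxx in qI.
rewrite !tcrd_basis eqxx mul1r !mul0r !addr0.
(* The direction d/dp^{I,i} does not move the jet, so L and vol drop out of the equation. *)
have -> : jpart (tbasis (wpI (k := k.+1) al I i) : 'rV[R]_#|widx m n k.+1|) = 0.
  by apply: tcrd_inj => t; rewrite tcrd_tvec tcrd_basis /tcrd mxE.
rewrite derive0 mulr0 => E; apply/eqP; rewrite eq_sym -subr_eq0; apply/eqP; apply: E.
by move=> a; rewrite tcrd_basis.
Qed.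

Lemma crd_bottom y al : Y y ->
  tcrd (crd c y) (wu al (mi0 k.+1)) = fibre_part c phi al y.
Proof.
move=> Yy; have [_ VU Vc Vd _] := cV; have [_ HU] := sigma_section.
have [_ base _] := HU _ (VU _ (YV Yy)).
rewrite /crd /wu wcrd_jet jcrd_fibre mi_seq0 /= /fibre_part cfunK //.
by rewrite base; exact: Vc (YV Yy).
Qed.

(** Induction runs over lists of directions, matching the recursion of [iterD]; [mi_in_count]
    returns to multi-indices. *)
Lemma crd_fibre y al (s : seq 'I_m) : (size s <= k.+1)%N -> Y y ->
  tcrd (crd c y) (wu al (mi_in k.+1 (fun i => count_mem i s))) =
  iterD s (fibre_part c phi al) y.
Proof.
elim: s y => [|i s IH] y /= sk Yy.
  rewrite -crd_bottom //; congr (tcrd _ (wu _ _)); apply: mi_fun_inj => i.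
  by rewrite mi0_fun mi_inK // big1.
rewrite -(eq_derive_on _ oY Yy (fun z => IH z (ltnW sk))).
(* The tail s has length at most k, so it indexes a momentum p^{I,i} and [derive_crd_fibre] applies
   to it. *)
pose I : mi m k := mi_in k (fun i => count_mem i s).
have IE : mi_fun I =1 (fun i => count_mem i s) by apply: mi_inK; rewrite sum_count_mem.
have -> : mi_in k.+1 (fun i => count_mem i s) = mi_in k.+1 (mi_fun I).
  by congr mi_in; apply/funext => j; rewrite IE.
rewrite derive_crd_fibre //; congr (tcrd _ (wu _ _)); rewrite /mi_succ; congr mi_in.
by apply/funext => j; rewrite IE addnC eq_sym.
Qed.

Lemma jpart_crd y : Y y -> jpart (crd c y) = jcrd k.+1 c phi (cinv (fcb c) y).
Proof.
move=> Yy; apply: tcrd_inj => -[i|[al J]]; rewrite tcrd_tvec.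
  by rewrite jcrd_base YK //; exact: crd_base.
rewrite jcrd_fibre YK // -crd_fibre ?mi_in_count // size_mi_seq.
exact: mi_fun_le.
Qed.

Lemma smooth_fibre_part al : smooth_on Y (fibre_part c phi al).
Proof.
apply: (eq_smooth_on oY _ (smooth_crd (wu al (mi0 k.+1)))) => y.
exact: crd_bottom.
Qed.

End InChart.

(** In a chart, phi is the order-zero part of sigma, that is [crd] followed by the smooth
    projections [jpart] and [jbottom]. *)
Lemma lsec_sigma x : U x -> lsec x phi.
Proof.
move=> Ux; have [oU HU] := sigma_section; split.
  apply: filterS (near_open oU Ux) => y Uy; have [_ base _] := HU y Uy.
  rewrite -[RHS]base; exact: jtotal_proj.
move=> c cx; have [V cV Vx] := chart_domain_exists Ux cx.
have [oV VU Vc Vd sV] := cV; exists V; split=> //.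
have oY : open (cfun (fcb c) @` V) by exact: open_cfun_image.
have oT p : open [set: 'rV[R]_p] by exact: openT.
have sj := smooth_on_comp_row oY (oT _) (fun _ _ => I) sV (@smooth_jpart R m n k.+1).
apply: (eq_smooth_on oY _ (smooth_on_comp_row oY (oT _) (fun _ _ => I) sj (@smooth_jbottom R m n k.+1))).
move=> _ [y Vy <-] /=; rewrite /crd jpart_wcrd cfunK; last exact: Vc.
rewrite jbottom_jcrd //; first exact: jrep_lsec.
exact: Vd.
Qed.

Lemma sigma_holonomic x (j : lsec x phi) : U x -> wjet (sigma x) = jet_at k.+1 j.
Proof.
move=> Ux; have [_ HU] := sigma_section; have [_ base _] := HU x Ux.
apply: jet_eq_base => //; rewrite -[jbase _]/(wbase _) base; split=> [|c cx].
  by rewrite /phi /wtotal /jtotal -[jbase _]/(wbase _) base.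
have cx' : cdom (fct c) (phi x) by rewrite /phi /wtotal /jtotal -[jbase _]/(wbase _) base.
have [V cV Vx] := chart_domain_exists Ux cx'.
have [_ _ Vc _ _] := cV.
have E : jpart (crd c (cfun (fcb c) x)) = jcrd k.+1 c (jrep (wjet (sigma x))) x.
  by rewrite /crd cfunK ?jpart_wcrd ?base //; exact: Vc.
rewrite -E (jpart_crd cV) //.
by rewrite cfunK //; exact: Vc.
Qed.

End HolonomicSections.

(** * The Euler-Lagrange equations *)

Section TotalDerivatives.
Context {R : realType} {m n : nat} {B : fbundle R m n}.
Implicit Types (c : fchart B) (phi : base B -> total B).

Lemma jtrunc_jcrd r l c phi x : (l <= r)%N -> jtrunc l (jcrd r c phi x) = jcrd l c phi x.
Proof.
move=> lr; apply: tcrd_inj => -[i|[al J]]; rewrite tcrd_tvec ?jcrd_base // !jcrd_fibre.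
rewrite (eq_mi_seq (K := J)) //; apply: mi_in_fun; exact: leq_trans (mi_fun_le J) lr.
Qed.

Lemma jbottom_jtrunc r l (y : 'rV[R]_#|jidx m n r|) : jbottom (jtrunc l y) = jbottom y.
Proof.
rewrite /jbottom; congr row_mx; apply/rowP => j; rewrite !mxE tcrd_tvec //.
congr (tcrd _ (inr (_, _))); apply: mi_fun_inj => i.
by rewrite mi_in_fun ?mi0_fun // /mi_norm big1 // => i' _; rewrite mi0_fun.
Qed.

Lemma smooth_jtrunc r l (U : set 'rV[R]_#|jidx m n r|) : open U -> smooth_on U (@jtrunc R m n r l).
Proof.
move=> oU; apply: smooth_on_row => // j.
case E : (enum_val j) => [i|[al J]].
  apply: (eq_smooth_on oU _ (@smooth_tcrd R _ U (inl i : jidx m n r))) => y _.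
  by rewrite mxE E.
apply: (eq_smooth_on oU _ (@smooth_tcrd R _ U (inr (al, mi_in r (mi_fun J)) : jidx m n r))) => y _.
by rewrite mxE E.
Qed.

(** Truncation keeps [jbottom], so it sends the chart image of order r.+1 into that of order r. *)
Lemma smooth_dtot r c i (F : 'rV[R]_#|jidx m n r| -> R) :
  smooth_on (@jdom R m n B r c) (F : _ -> R^o) ->
  smooth_on (@jdom R m n B r.+1 c) (dtot i F : _ -> R^o).
Proof.
move=> sF; have oD : open (@jdom R m n B r c) by exact: open_jdom.
have oD' : open (@jdom R m n B r.+1 c) by exact: open_jdom.
have spd t : smooth_on (@jdom R m n B r.+1 c) (fun y => pd t F (jtrunc r y) : R^o).
  apply: (@smooth_on_comp R _ _ _ (@jdom R m n B r c) (@jtrunc R m n r.+1 r)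
    (pd t F : _ -> R^o) oD' oD).
  - by move=> y; rewrite /jdom /= jbottom_jtrunc.
  - exact: smooth_jtrunc.
  exact: smooth_on_derive.
apply: smooth_onD => //; apply: smooth_on_sum => // al; apply: smooth_on_sum => // J.
by apply: smooth_onM => //; exact: smooth_tcrd.
Qed.

Lemma smooth_dtots r c s (F : 'rV[R]_#|jidx m n r| -> R) :
  smooth_on (@jdom R m n B r c) (F : _ -> R^o) ->
  smooth_on (@jdom R m n B (size s + r) c) (@dtots R m n r s F : _ -> R^o).
Proof. by move=> sF; elim: s => //= i s IH; exact: (smooth_dtot i IH). Qed.

(** By the chain rule: the components of the velocity of the prolongation are the coefficients in
    the definition of [dtot]. *)
Lemma dtot_jcrd r c phi (V : set (base B)) i (F : 'rV[R]_#|jidx m n r| -> R) x :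
  open V -> V `<=` cdom (fcb c) ->
  (forall al, smooth_on (cfun (fcb c) @` V) (fibre_part c phi al)) -> V x ->
  differentiable (F : _ -> R^o) (jcrd r c phi x) ->
  dtot i F (jcrd r.+1 c phi x) =
  'D_(delta_mx 0 i) (fun y => F (jcrd r c phi (cinv (fcb c) y)) : R^o) (cfun (fcb c) x).
Proof.
move=> oV Vc sV Vx dF.
have Yx : (cfun (fcb c) @` V) (cfun (fcb c) x) by exists x.
have sj := @smooth_jcrd R m n B r V c phi oV Vc sV.
have dj := smooth_on_differentiable sj Yx.
rewrite -[RHS]/('D_(delta_mx 0 i)
  ((F : _ -> R^o) \o (fun y => jcrd r c phi (cinv (fcb c) y))) (cfun (fcb c) x)).
rewrite derive_comp_row //; last by rewrite cfunK //; exact: Vc.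
rewrite (derive_jcrd_local r i oV Vc sV Vx) cfunK; last exact: Vc.
rewrite (reindex (@enum_rank (jidx m n r))) /=; last first.
  by exists enum_val => t _; rewrite ?enum_rankK ?enum_valK.
rewrite big_sumType /= /dtot jtrunc_jcrd //; congr (_ + _).
  rewrite (bigD1 i) //= big1 ?addr0 => [|j ji].
    by rewrite -[X in X * _]/(tcrd _ _) dtot_vec_base eqxx mul1r.
  by rewrite -[X in X * _]/(tcrd _ _) dtot_vec_base (negbTE ji) mul0r.
rewrite pair_bigA /=; apply: eq_bigr => -[al J] _.
by rewrite -[X in _ = X * _]/(tcrd _ _) dtot_vec_fibre.
Qed.

(** Each step differentiates the previous total derivative at a jet of phi, which is why smoothness
    is carried on the whole open image [jdom]. *)
Lemma dtots_jcrd r c phi (V : set (base B)) s (F : 'rV[R]_#|jidx m n r| -> R) :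
  open V -> V `<=` cdom (fcb c) ->
  (forall al, smooth_on (cfun (fcb c) @` V) (fibre_part c phi al)) ->
  (forall x, V x -> lsec x phi /\ cdom (fct c) (phi x)) ->
  smooth_on (@jdom R m n B r c) (F : _ -> R^o) ->
  forall x, V x -> @dtots R m n r s F (jcrd (size s + r) c phi x) =
    iterD s (fun y => F (jcrd r c phi (cinv (fcb c) y))) (cfun (fcb c) x).
Proof.
move=> oV Vc sV phiV sF; have oY : open (cfun (fcb c) @` V) by exact: open_cfun_image.
elim: s => [|i s IH] x Vx; first by rewrite /= cfunK //; exact: Vc.
have [hx cx] := phiV x Vx.
rewrite /= (dtot_jcrd i oV Vc sV Vx).
  apply: (eq_derive_on _ oY); first by exists x.
  by move=> _ [y Vy <-]; rewrite -IH // cfunK //; exact: Vc.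
apply: (smooth_on_differentiable (smooth_dtots (c := c) s sF)).
by rewrite /jdom /= jbottom_jcrd //; exists (phi x).
Qed.

End TotalDerivatives.

Lemma sum_pair_only (I J : finType) (V : nmodType) (F : I * J -> V) a :
  (forall q, q.1 != a -> F q = 0) -> \sum_q F q = \sum_j F (a, j).
Proof.
move=> F0; rewrite (eq_bigr (fun q => F (q.1, q.2))) => [|[]//].
rewrite -(pair_bigA _ (fun i j => F (i, j))) (bigD1 a) //= [X in _ + X]big1 ?addr0 // => i ia.
by rewrite big1 // => j _; rewrite F0.
Qed.

(* Here P^{I,i} are the momenta along sigma and G^J = dL/du_J: the term D_i P^{I,i}
   of G^I cancels the term P^{I,i} of G^(I+1_i). *)
Lemma alternating_sum (R : realType) (m k : nat) (Y : set 'rV[R]_m) (P : mi m k -> 'I_m -> 'rV[R]_m -> R^o)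
    (G : mi m k.+1 -> 'rV[R]_m -> R^o) : open Y ->
  (forall I i, smooth_on Y (P I i)) ->
  (forall J y, Y y -> G J y = \sum_(i < m) \sum_(I : mi m k)
     ((mi_in k.+1 (mi_fun I) == J)%:R * 'D_(delta_mx 0 i) (P I i) y +
      (mi_succ I i == J)%:R * P I i y)) ->
  forall y, Y y -> \sum_J (-1) ^+ mi_norm J * iterD (mi_seq J) (G J) y = 0.
Proof.
move=> oY sP GE y Yy.
pose A I i J := (-1) ^+ mi_norm J * ((mi_in k.+1 (mi_fun I) == J)%:R *
    iterD (mi_seq J) ('D_(delta_mx 0 i) (P I i)) y +
    (mi_succ I i == J)%:R * iterD (mi_seq J) (P I i) y).
rewrite (eq_bigr (fun J => \sum_(i < m) \sum_(I : mi m k) A I i J)) => [|J _]; last first.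
  have sM (a : bool) (f : 'rV[R]_m -> R^o) : smooth_on Y f -> smooth_on Y (fun z => a%:R * f z : R^o).
    by move=> sf; apply: smooth_onM => //; exact: smooth_on_cst.
  have sD I i : smooth_on Y ('D_(delta_mx 0 i) (P I i)) by exact: smooth_on_derive.
  have sA I i := smooth_onD oY (sM (mi_in k.+1 (mi_fun I) == J) _ (sD I i))
    (sM (mi_succ I i == J) _ (sP I i)).
  rewrite (eq_iterD _ oY (GE J)) // (iterD_sum _ _ oY) //; last first.
    by move=> i; apply: smooth_on_sum => // I; exact: sA.
  rewrite mulr_sumr; apply: eq_bigr => i _.
  rewrite (iterD_sum _ _ oY) //.
  rewrite mulr_sumr; apply: eq_bigr => I _; congr (_ * _).
  by rewrite (iterDD _ oY) // ?(iterDZ _ _ oY) //; exact: sM.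
rewrite exchange_big big1 //= => i _; rewrite exchange_big big1 //= => I _.
have sel (J0 : mi m k.+1) (F : mi m k.+1 -> R) :
    \sum_J (-1) ^+ mi_norm J * ((J0 == J)%:R * F J) = (-1) ^+ mi_norm J0 * F J0.
  rewrite (bigD1 J0) //= eqxx mul1r big1 ?addr0 // => J JJ0.
  by rewrite eq_sym (negbTE JJ0) mul0r mulr0.
rewrite /A; under eq_bigr do rewrite mulrDr.
rewrite big_split /= !sel.
have -> : mi_norm (mi_succ I i) = (mi_norm I).+1.
  by rewrite -!size_mi_seq (perm_size (perm_mi_succ I i)).
have IE : mi_seq (mi_in k.+1 (mi_fun I)) = mi_seq I.
  by apply: eq_mi_seq; apply: mi_in_fun; apply: leqW; exact: mi_fun_le.
rewrite -(size_mi_seq (mi_in _ _)) IE size_mi_seq.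
rewrite (perm_iterD oY (sP I i) (perm_mi_succ I i) Yy) /= -(iterD_deriveC _ _ oY (sP I i) Yy).
by rewrite exprS mulN1r mulNr subrr.
Qed.

Section EulerLagrange.
Context {R : realType} {m n k : nat} {B : fbundle R m n}.
Context (eta : volume_form (base B)) (Phi : W0 B k.+1 -> R) (L : jet B k.+1 -> R).
Hypotheses (Phi_pairing : is_pairing eta Phi)
  (L_smooth : smooth_fun (X := Jspace B k.+1) L).
Context (S : set (W0 B k.+1)) (h : W0 B k.+1 -> fchart B -> 'M[R]_#|widx m n k.+1|).
Hypotheses (h_connection : connection_along S h)
  (h_solution : forall w, S w -> dynamical_eq eta Phi L w (h w)).
Context (U : set (base B)) (sigma : base B -> W0 B k.+1).
Hypotheses (sigma_section : section_on S U sigma)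
  (sigma_integral : integral_section h U sigma).

Let phi (x : base B) : total B := wtotal (sigma x).

Lemma sigma_euler_lagrange c x al : U x -> adapted eta c -> cdom (fct c) (phi x) ->
  euler_lagrange (rep (X := Jspace B k.+1) c L) al (jcrd (2 * k.+1) c phi x) = 0.
Proof.
move=> Ux ad cx; have [V cV Vx] := chart_domain_exists sigma_section Ux cx.
have [oV VU Vc Vd sV] := cV.
have oY : open (cfun (fcb c) @` V) by exact: open_cfun_image.
set LJ : 'rV[R]_#|jidx m n k.+1| -> R := rep (X := Jspace B k.+1) c L.
pose crd y := wcrd c (sigma (cinv (fcb c) y)).
pose P (I : mi m k) (i : 'I_m) y : R^o := tcrd (crd y) (wpI (k := k.+1) al I i).
pose G (J : mi m k.+1) y : R^o := pd (inr (al, J) : jidx m n k.+1) LJ (jcrd k.+1 c phi (cinv (fcb c) y)).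
have sLJ : smooth_on (@jdom R m n B k.+1 c) (LJ : _ -> R^o) by exact: smooth_rep.
rewrite /euler_lagrange.
(* Along the prolongation of phi, total derivatives become ordinary ones; this replacement is
   justified last, by [dtots_jcrd]. *)
rewrite (eq_bigr (fun J => (-1) ^+ mi_norm J * iterD (mi_seq J) (G J) (cfun (fcb c) x))) => [|J _].
  apply: (alternating_sum (Y := cfun (fcb c) @` V) (P := P)) => //.
  - by move=> I i; exact: smooth_crd cV _.
  move=> J y Yy.
  have := sigma_equation Phi_pairing L_smooth h_connection h_solution sigma_section
    sigma_integral cV (xi := tbasis (wu al J)) Yy.
  have yV : V (cinv (fcb c) y) by case: Yy => z Vz <-; rewrite cfunK //; exact: Vc.
  (* Adaptedness enters here: otherwise vol would be differentiated along with dL/du_J. *)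
  rewrite (ad _ (Vc _ yV)) mul1r.
  have -> : jpart (tbasis (wu al J) : 'rV[R]_#|widx m n k.+1|) = tbasis (inr (al, J)).
    by apply: tcrd_inj => t; rewrite tcrd_tvec !tcrd_basis.
  rewrite (jpart_crd Phi_pairing L_smooth h_connection h_solution sigma_section sigma_integral cV Yy).
  move=> E; rewrite -[LHS]E; last by move=> a; rewrite tcrd_basis.
  (* The direction d/du^al_J meets only momenta with the same fibre index al. *)
  apply: eq_bigr => i _; rewrite (sum_pair_only (a := al)) => [|[al' I] /= al'al]; last first.
    have ne K K' : (wu al' K == wu al K' :> widx m n k.+1) = false.
      by apply/eqP => -[E' _]; rewrite E' eqxx in al'al.
    by rewrite !tcrd_basis !ne !mul0r !addr0.
  apply: eq_bigr => I _; rewrite !tcrd_basis mul0r add0r.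
  have wuE K K' : (wu al K == wu al K' :> widx m n k.+1) = (K == K').
    by apply/eqP/eqP => [[]|->].
  by rewrite !wuE.
(* Truncation from order 2(k+1) to |J| + k + 1 is legitimate because |J| <= k + 1. *)
congr (_ * _); rewrite jtrunc_jcrd; last first.
  by rewrite size_mi_seq mul2n -addnn leq_add2r; exact: mi_fun_le.
apply: (dtots_jcrd (V := V)) => //.
- move=> al'; exact: (smooth_fibre_part sigma_section cV).
- move=> y Vy; split; last exact: Vd.
  exact: (lsec_sigma sigma_section (VU _ Vy)).
exact: smooth_on_derive sLJ.
Qed.

End EulerLagrange.

Theorem proposition3p6 (R : realType) (m n k : nat) (hk : (1 <= k)%N)
    (B : fbundle R m n) (eta : volume_form (base B))
    (L : jet B k -> R) (L_smooth : smooth_fun (X := Jspace B k) L)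
    (Phi : W0 B k -> R) (Phi_pairing : is_pairing eta Phi)
    (W_sub : forall r, submanifold (X := Wspace k) (Wr eta Phi L r))
    (f : nat) (W_stable : forall r, (f <= r)%N ->
       Wr eta Phi L r = Wr eta Phi L f)
    (Wf_fibred : fibred_over_open (Wr eta Phi L f))
    (h : W0 B k -> fchart B -> 'M[R]_#|widx m n k|)
    (h_connection : connection_along (Wr eta Phi L f) h)
    (h_solution : forall w, Wr eta Phi L f w -> dynamical_eq eta Phi L w (h w))
    (U : set (base B)) (sigma : base B -> W0 B k)
    (sigma_section : section_on (Wr eta Phi L f) U sigma)
    (sigma_integral : integral_section h U sigma) :
  forall x, U x ->
    exists j : lsec x (fun y => wtotal (sigma y)),
      wjet (sigma x) = jet_at k j /\
      forall c : fchart B, adapted eta c ->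
        cs_dom c (jet_at (2 * k)%N j : Jspace B (2 * k)%N) ->
        forall al : 'I_n,
          euler_lagrange (rep (X := Jspace B k) c L) al
            (cs_crd c (jet_at (2 * k)%N j : Jspace B (2 * k)%N)) = 0.
Proof.
case: k hk L L_smooth Phi Phi_pairing W_sub f W_stable Wf_fibred h h_connection
  h_solution U sigma sigma_section sigma_integral => // k _ L L_smooth Phi
  Phi_pairing _ f _ _ h h_connection h_solution U sigma sigma_section sigma_integral x Ux.
exists (lsec_sigma sigma_section Ux); split.
  exact: (sigma_holonomic Phi_pairing L_smooth h_connection h_solution sigma_section sigma_integral).
move=> c ad cz al; rewrite /= jtotal_jet_at in cz.
rewrite /= jcrd_jet_at //.
exact: (sigma_euler_lagrange Phi_pairing L_smooth h_connection h_solution sigma_section sigma_integral).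
Qed.
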